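(* Let $n\ge 2$ be an integer, let $p_1,\dots,p_n$ be distinct primes, and let $G_n$ be the group defined in the context. Then $G_n$ has exactly countably many (that is, countably infinitely many) distinct orders. In other words, the space of orders $\mathbb X(G_n)$ is countable.
   Context: Orders. An order on a group $G$ is a strict total order $<$ on $G$ that is bi-invariant: $a<b$ implies $ca<cb$ and $ac<bc$ for all $a,b,c\in G$. Orders correspond bijectively to positive cones, i.e. subsets $P\subseteq G$ with $G=P\sqcup P^{-1}\sqcup\{1\}$, $P\cdot P\subseteq P$, $gPg^{-1}\subseteq P$ for all $g\in G$, via $P=\{g: 1<g\}$. The space of orders $\mathbb X(G)$ is the set of all positive cones of $G$. The group $G_n$. Let $A=\{m/2^k: m,k\in\mathbb Z\}$ be the additive group of dyadic rationals and $X=\{x\in A: 0\le x<1\}$. For $1\le i\le n$, $z\in\mathbb Z$, $x\in X$ let $H^i_{z,x}$ be a copy of $(\mathbb Q,+)$, written multiplicatively; $h^{i,r}_{z,x}$ denotes its element corresponding to $r\in\mathbb Q$ (so $h^{i,r}_{z,x}h^{i,s}_{z,x}=h^{i,r+s}_{z,x}$). Let $H^i_z=\bigoplus_{x\in X}H^i_{z,x}$, $H^i=\bigoplus_{z\in\mathbb Z}H^i_z$, and $P_n=H^1\times\cdots\times H^n$. Write elements of $A$ multiplicatively as $\lambda^\alpha$ ($\alpha\in A$), and elements of $\mathbb Z$ as $\zeta^\beta$ ($\beta\in\mathbb Z$). Let $M_n=P_n\rtimes A$, with conjugation action determined by $\lambda^{-\alpha}h^{i,r}_{z,x}\lambda^{\alpha}=h^{i,\,rp_i^m}_{z,\,x+\alpha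 2^z-m}$, where $m\in\mathbb Z$ is the integer with $m\le x+\alpha2^z<m+1$. Let $G_n=M_n\rtimes\mathbb Z$, with conjugation action determined by $\zeta^{-\beta}h^{i,r}_{z,x}\zeta^\beta=h^{i,r}_{z+\beta,x}$ and $\zeta^{-\beta}\lambda^\alpha\zeta^\beta=\lambda^{\alpha/2^\beta}$. *)

(* Defs.v *)
From HB Require Import structures.
From mathcomp Require Import all_boot all_order all_algebra.
From mathcomp Require Import finmap monalg ring.
From mathcomp Require Import boolp classical_sets functions cardinality.

Set Implicit Arguments.
Unset Strict Implicit.
Unset Printing Implicit Defensive.

Import Order.TTheory GRing.Theory Num.Theory.

Local Open Scope classical_set_scope.
Local Open Scope ring_scope.

(** * Orders on a group *)

Record is_order (G : groupType) (lt : G -> G -> Prop) : Prop := IsOrder {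
  order_irr : forall a, ~ lt a a;
  order_trans : forall a b c, lt a b -> lt b c -> lt a c;
  order_total : forall a b, lt a b \/ a = b \/ lt b a;
  order_mull : forall a b c, lt a b -> lt (c * a)%g (c * b)%g;
  order_mulr : forall a b c, lt a b -> lt (a * c)%g (b * c)%g }.

Record is_positive_cone (G : groupType) (P : set G) : Prop := IsPositiveCone {
  cone_cover : [set: G] = P `|` [set (g^-1)%g | g in P] `|` [set 1%g];
  cone_disjV : P `&` [set (g^-1)%g | g in P] = set0;
  cone_disj1 : P `&` [set 1%g] = set0;
  coneV_disj1 : [set (g^-1)%g | g in P] `&` [set 1%g] = set0;
  cone_mul : forall a b, P a -> P b -> P (a * b)%g;
  cone_conj : forall g a, P a -> P (g * a * g^-1)%g }.

Definition orders (G : groupType) : set (G -> G -> Prop) :=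
  [set lt | is_order lt].

Definition space_of_orders (G : groupType) : set (set G) :=
  [set P | is_positive_cone P].

Arguments orders : clear implicits.
Arguments space_of_orders : clear implicits.

(** * Additive groups in multiplicative notation *)

Definition mult (V : zmodType) : Type := V.

Section Mult.
Variable V : zmodType.

HB.instance Definition _ := Choice.on (mult V).

HB.instance Definition _ := isGroup.Build (mult V)
  (@addrA V) (@add0r V) (@addr0 V) (@addNr V) (@addrN V).

Lemma mult1E : 1%g = 0 :> mult V. Proof. by []. Qed.
Lemma multME (x y : mult V) : (x * y)%g = (x : V) + (y : V). Proof. by []. Qed.
Lemma multVE (x : mult V) : (x^-1)%g = - (x : V). Proof. by []. Qed.
Lemma multC (x y : mult V) : (x * y)%g = (y * x)%g.
Proof. exact: (@addrC V). Qed.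

End Mult.

(** * Semidirect products *)

Record acts_by_automorphisms (K Q : groupType) (phi : K -> Q -> K) : Prop :=
  ActsByAutomorphisms {
    actM : forall q k k', phi (k * k')%g q = (phi k q * phi k' q)%g;
    act1 : forall k, phi k 1%g = k;
    actA : forall q q' k, phi k (q * q')%g = phi (phi k q) q' }.

(* The pair (q, k) stands for the product q k, and phi k q is q^-1 k q:
   see [sdprod_pairE] and [sdprod_conj]. *)
Definition sdprod (K Q : groupType) (phi : K -> Q -> K)
  (phiP : acts_by_automorphisms phi) : Type := (Q * K)%type.

Section Sdprod.
Variables (K Q : groupType) (phi : K -> Q -> K).
Variable phiP : acts_by_automorphisms phi.

Local Notation S := (sdprod phiP).

HB.instance Definition _ := Choice.copy S (Q * K)%type.

Definition sdprod_mul (x y : S) : S :=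
  ((x.1 * y.1)%g, (phi x.2 y.1 * y.2)%g).
Definition sdprod_one : S := (1%g, 1%g).
Definition sdprod_inv (x : S) : S := ((x.1^-1)%g, phi (x.2^-1)%g (x.1^-1)%g).

Lemma act_id q : phi 1%g q = 1%g.
Proof.
by apply: (mulgI (phi 1%g q)); rewrite -(actM phiP) !mulg1.
Qed.

Lemma sdprod_mulA : associative sdprod_mul.
Proof.
move=> [a x] [b y] [c z]; rewrite /sdprod_mul /=.
by rewrite (actM phiP) -(actA phiP) !mulgA.
Qed.

Lemma sdprod_mul1 : left_id sdprod_one sdprod_mul.
Proof. by move=> [a x]; rewrite /sdprod_mul /= act_id !mul1g. Qed.

Lemma sdprod_1mul : right_id sdprod_one sdprod_mul.
Proof. by move=> [a x]; rewrite /sdprod_mul /= (act1 phiP) !mulg1. Qed.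

Lemma sdprod_mulV : left_inverse sdprod_one sdprod_inv sdprod_mul.
Proof.
move=> [a x]; rewrite /sdprod_mul /sdprod_inv /= -(actA phiP) mulVg.
by rewrite (act1 phiP) mulVg.
Qed.

Lemma sdprod_Vmul : right_inverse sdprod_one sdprod_inv sdprod_mul.
Proof.
move=> [a x]; rewrite /sdprod_mul /sdprod_inv /= -(actM phiP) !mulgV.
by rewrite act_id.
Qed.

HB.instance Definition _ := isGroup.Build S
  sdprod_mulA sdprod_mul1 sdprod_1mul sdprod_mulV sdprod_Vmul.

Definition sd_inl (k : K) : S := (1%g, k).
Definition sd_inr (q : Q) : S := (q, 1%g).

Lemma sd_inlM k k' : sd_inl (k * k')%g = (sd_inl k * sd_inl k')%g.
Proof. by congr pair; rewrite /= ?mulg1 ?(act1 phiP). Qed.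

Lemma sd_inrM q q' : sd_inr (q * q')%g = (sd_inr q * sd_inr q')%g.
Proof. by congr pair; rewrite /= act_id mulg1. Qed.

Lemma sdprod_pairE q k : (q, k) = (sd_inr q * sd_inl k)%g :> S.
Proof. by congr pair; rewrite /= ?mulg1 ?act_id ?mul1g. Qed.

Lemma sdprod_conj q k : (sd_inl k ^ sd_inr q)%g = sd_inl (phi k q).
Proof.
have -> : (sd_inl k ^ sd_inr q)%g
        = sdprod_mul (sdprod_inv (sd_inr q)) (sdprod_mul (sd_inl k) (sd_inr q)).
  by [].
rewrite /sdprod_mul /sdprod_inv /= mul1g mulg1 mulVg.
by rewrite invg1 act_id act_id mul1g.
Qed.

Lemma sd_inlJ k k' : (sd_inl k ^ sd_inl k')%g = sd_inl (k ^ k')%g.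
Proof.
apply: (mulgI (sd_inl k')).
by rewrite -[RHS]sd_inlM /conjg -sd_inlM !mulgA !mulgV !mul1g.
Qed.

End Sdprod.

(** * Dyadic rationals *)

Definition dyadic : {pred rat} :=
  fun x => `[< exists m k : int, x = m%:~R / 2 ^ k >].

Lemma dyadicB : zmod_closed dyadic.
Proof.
have clear_den x : x \in dyadic -> exists l : nat, forall N, (l <= N)%N ->
    exists b : int, x * 2 ^ N = b%:~R.
  move=> /asboolP[m [k ->]]; exists `|k|%N => N kN.
  have N_ge : 0 <= N%:Z - k.
    by rewrite subr_ge0 (le_trans (ler_norm k)) // -abszE lez_nat.
  exists (m * 2 ^+ `|N%:Z - k|%N); rewrite rmorphM rmorphXn /=.
  rewrite -mulrA; congr (_ * _); rewrite [RHS]exprnP gez0_abs //.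
  by rewrite mulrC expfzDr // invr_expz.
split=> [|x y /clear_den[l lE] /clear_den[l' l'E]].
  by apply/asboolP; exists 0, 0; rewrite mul0r.
have [b bE] := lE _ (leq_addr l' l); have [b' b'E] := l'E _ (leq_addl l l').
apply/asboolP; exists (b - b'), (l + l')%N.
by rewrite rmorphB /= -bE -b'E -mulrBl mulfK // expfz_neq0.
Qed.

HB.instance Definition _ := GRing.isZmodClosed.Build rat dyadic dyadicB.

Lemma dyadic_int (m : int) : m%:~R \in dyadic.
Proof. by apply/asboolP; exists m, 0; rewrite divr1. Qed.

Lemma dyadic_pow2M (x : rat) (z : int) : x \in dyadic -> x * 2 ^ z \in dyadic.
Proof.
move=> /asboolP[m [k ->]]; apply/asboolP; exists m, (k - z).
by rewrite expfzDr // invfM mulrA -(invr_expz _ z) invrK.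
Qed.

Record dyadicA : Type := DyadicA {
  dyadicA_val :> rat;
  _ : dyadicA_val \in dyadic }.

HB.instance Definition _ := [isSub for dyadicA_val].
HB.instance Definition _ := [Choice of dyadicA by <:].
HB.instance Definition _ := [SubChoice_isSubZmodule of dyadicA by <:].

Record dyadicX : Type := DyadicX {
  dyadicX_val :> rat;
  _ : (dyadicX_val \in dyadic) && (0 <= dyadicX_val < 1) }.

HB.instance Definition _ := [isSub for dyadicX_val].
HB.instance Definition _ := [Choice of dyadicX by <:].

Lemma dyadicA_in (a : dyadicA) : (a : rat) \in dyadic.
Proof. exact: valP a. Qed.

Lemma dyadicX_in (x : dyadicX) : (x : rat) \in dyadic.
Proof. by case/andP: (valP x). Qed.

Definition dyadicA_pow2M (a : dyadicA) (z : int) : dyadicA :=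
  DyadicA (dyadic_pow2M z (dyadicA_in a)).

Lemma shift_dyadic (z : int) (x : dyadicX) (a : dyadicA) :
  (x : rat) + (a : rat) * 2 ^ z \in dyadic.
Proof. by rewrite rpredD ?dyadicX_in // dyadic_pow2M ?dyadicA_in. Qed.

Lemma frac_dyadicX (t : rat) : t \in dyadic ->
  (t - (Num.floor t)%:~R \in dyadic) && (0 <= t - (Num.floor t)%:~R < 1).
Proof.
move=> tA; rewrite rpredB ?dyadic_int //= subr_ge0 ltrBlDl.
by rewrite -[X in _ + X]/(1%:~R) -intrD; exact: floor_itv.
Qed.

(* The integer m with m <= x + a 2^z < m + 1, and the point x + a 2^z - m. *)
Definition shift_floor (z : int) (x : dyadicX) (a : dyadicA) : int :=
  Num.floor ((x : rat) + (a : rat) * 2 ^ z).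

Definition shift_frac (z : int) (x : dyadicX) (a : dyadicA) : dyadicX :=
  DyadicX (frac_dyadicX (shift_dyadic z x a)).

Lemma shift_fracE z x a : val (shift_frac z x a)
  = (x : rat) + (a : rat) * 2 ^ z - (shift_floor z x a)%:~R.
Proof. by []. Qed.

(** * The group G_n *)

(* {malg rat[K]}, the finitely supported functions from K to rat, is the direct
   sum of copies of rat indexed by K.  relabel c s is its endomorphism sending
   the element r of the k-th copy to the element r * c k of the (s k)-th. *)
Definition relabel (K : choiceType) (c : K -> rat) (s : K -> K)
    (f : {malg rat[K]}) : {malg rat[K]} :=
  \sum_(k <- msupp f) << f@_k * c k *g s k >>.

Section Relabel.
Variable K : choiceType.
Implicit Types (c : K -> rat) (s : K -> K) (f : {malg rat[K]}).

Lemma relabelEw (d : {fset K}) c s f : (msupp f `<=` d)%fset ->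
  relabel c s f = \sum_(k <- d) << f@_k * c k *g s k >>.
Proof.
move=> fd; rewrite /relabel (big_fset_incl _ fd) // => k _ /mcoeff_outdom ->.
by rewrite mul0r monalgU0.
Qed.

Lemma relabelD c s : {morph relabel c s : f g / f + g}.
Proof.
move=> f g; pose d := (msupp f `|` msupp g)%fset.
rewrite (@relabelEw d _ _ (f + g)) ?msuppD_le //.
rewrite (@relabelEw d _ _ f) ?fsubsetUl // (@relabelEw d _ _ g) ?fsubsetUr //.
rewrite -big_split /=; apply: eq_bigr => k _.
by rewrite mcoeffD mulrDl monalgUD.
Qed.

Lemma relabelU c s k r : relabel c s << r *g k >> = << r * c k *g s k >>.
Proof.
rewrite (@relabelEw [fset k]%fset) ?msuppU_le // big_seq_fset1.
by rewrite mcoeffUU.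
Qed.

Lemma relabel_sum c s (I : Type) (l : seq I) (F : I -> {malg rat[K]}) :
  relabel c s (\sum_(i <- l) F i) = \sum_(i <- l) relabel c s (F i).
Proof.
apply: (big_morph _ (relabelD c s)).
by rewrite /relabel msupp0 big_seq_fset0.
Qed.

Lemma relabel_comp c s c' s' f :
  relabel c' s' (relabel c s f)
  = relabel (fun k => c k * c' (s k)) (s' \o s) f.
Proof.
rewrite {2}/relabel relabel_sum; apply: eq_bigr => k _.
by rewrite relabelU mulrA.
Qed.

Lemma eq_relabel c s c' s' : c =1 c' -> s =1 s' ->
  relabel c s =1 relabel c' s'.
Proof. by move=> cE sE f; apply: eq_bigr => k _; rewrite cE sE. Qed.

Lemma relabel_id f : relabel (fun=> 1) id f = f.
Proof. by rewrite [RHS]monalgE; apply: eq_bigr => k _; rewrite mulr1. Qed.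

End Relabel.

Section G.
Variables (n : nat) (p : 'I_n -> nat).
Hypothesis p_prime : forall i, prime (p i).

(* (i, z, x) is the index of the summand H^i_{z,x} of P_n: the product of the
   finitely many H^i is their direct sum. *)
Definition idx : Type := ('I_n * int * dyadicX)%type.

HB.instance Definition _ := Choice.on idx.

Definition Pn : Type := mult {malg rat[idx]}.

HB.instance Definition _ := Group.on Pn.

(* Conjugation f |-> lambda^-a f lambda^a on P_n. *)
Definition lam_coef (a : dyadicA) (k : idx) : rat :=
  let: (i, z, x) := k in (p i)%:R ^ shift_floor z x a.

Definition lam_idx (a : dyadicA) (k : idx) : idx :=
  let: (i, z, x) := k in (i, z, shift_frac z x a).

Definition lam_act (f : Pn) (a : mult dyadicA) : Pn :=
  relabel (lam_coef a) (lam_idx a) f.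

Lemma lam_actP : acts_by_automorphisms lam_act.
Proof.
have shift_floorD z x (a b : dyadicA) : shift_floor z x (a + b)
    = shift_floor z x a + shift_floor z (shift_frac z x a) b.
  rewrite [in RHS]/shift_floor /= -/(shift_floor z x a).
  have -> : (x : rat) + (a : rat) * 2 ^ z - (shift_floor z x a)%:~R
      + (b : rat) * 2 ^ z = (x : rat) + ((a + b : dyadicA) : rat) * 2 ^ z
      + (- shift_floor z x a)%:~R by rewrite /= rmorphN /=; ring.
  by rewrite floorDrz ?intr_int // intrKfloor [RHS]addrC addrNK.
have shift_fracD z x (a b : dyadicA) : shift_frac z x (a + b)
    = shift_frac z (shift_frac z x a) b.
  apply: val_inj; rewrite [RHS]shift_fracE 2!shift_fracE shift_floorD.
  by rewrite intrD /=; ring.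
split=> [a f g|f|a b f].
- exact: relabelD.
- rewrite -[RHS]relabel_id; apply: eq_relabel => -[[i z] x] /=.
    rewrite /shift_floor mul0r addr0.
    have /andP[_ /andP[x0 x1]] := valP x.
    by rewrite (@floor_def _ _ 0) ?x0.
  congr (_, _); apply: val_inj; rewrite /= mul0r addr0.
  have /andP[_ /andP[x0 x1]] := valP x.
  by rewrite (@floor_def _ _ 0) ?x0 ?subr0.
- rewrite /lam_act relabel_comp; apply: eq_relabel => -[[i z] x] /=.
    rewrite shift_floorD expfzDr // pnatr_eq0 -lt0n.
    exact: prime_gt0.
  by rewrite -shift_fracD.
Qed.

Definition Mn : Type := sdprod lam_actP.

HB.instance Definition _ := Group.on Mn.

(* Conjugation g |-> zeta^-b g zeta^b on M_n: the element (a, f) of M_n is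
   lambda^a f. *)
Definition zeta_idx (b : int) (k : idx) : idx :=
  let: (i, z, x) := k in (i, z + b, x).

Definition zeta_act (g : Mn) (b : mult int) : Mn :=
  (dyadicA_pow2M g.1 (- b), relabel (fun=> 1) (zeta_idx b) g.2).

Lemma zeta_actP : acts_by_automorphisms zeta_act.
Proof.
split=> [b [a f] [a' f']|[a f]|b b' [a f]].
- have shiftE z (x : dyadicX) (c : dyadicA) :
    (x : rat) + (dyadicA_pow2M c (- b) : rat) * 2 ^ (z + b)
    = (x : rat) + (c : rat) * 2 ^ z.
    by congr (_ + _); rewrite /= -mulrA -expfzDr // [z + b]addrC addKr.
  have floorE z x c :
    shift_floor (z + b) x (dyadicA_pow2M c (- b)) = shift_floor z x c.
    by rewrite /shift_floor shiftE.
  have fracE z x c :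
    shift_frac (z + b) x (dyadicA_pow2M c (- b)) = shift_frac z x c.
    by apply: val_inj; rewrite !shift_fracE floorE shiftE.
  congr pair; first by apply: val_inj; exact: mulrDl.
  apply: (etrans (relabelD (fun=> 1) (zeta_idx b) (lam_act f a') f')).
  apply: (congr1 (fun u => u + relabel (fun=> 1) (zeta_idx b) f')).
  rewrite /lam_act !relabel_comp.
  apply: eq_relabel => -[[i z] x]; rewrite /lam_coef /lam_idx /=.
    by rewrite mulr1 mul1r floorE.
  by rewrite fracE.
- congr pair; first by apply: val_inj; rewrite /= oppr0 mulr1.
  rewrite -[RHS]relabel_id; apply: eq_relabel => -[[i z] x] //=.
  by rewrite addr0.
- congr pair; first by apply: val_inj; rewrite /= opprD -mulrA expfzDr.
  rewrite [RHS]relabel_comp; apply: eq_relabel => -[[i z] x] /=.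
    by rewrite mulr1.
  by rewrite addrA.
Qed.

Definition Gn : Type := sdprod zeta_actP.

HB.instance Definition _ := Group.on Gn.

Definition gen_h (i : 'I_n) (r : rat) (z : int) (x : dyadicX) : Gn :=
  sd_inl zeta_actP (sd_inl lam_actP (<< r *g (i, z, x) >> : Pn)).

Definition gen_lambda (a : dyadicA) : Gn :=
  sd_inl zeta_actP (sd_inr lam_actP (a : mult dyadicA)).

Definition gen_zeta (b : int) : Gn := sd_inr zeta_actP (b : mult int).

Lemma gen_hD i r s z x :
  gen_h i (r + s) z x = (gen_h i r z x * gen_h i s z x)%g.
Proof. by rewrite /gen_h monalgUD -multME !sd_inlM. Qed.

Lemma gen_lambdaD a a' : gen_lambda (a + a') = (gen_lambda a * gen_lambda a')%g.
Proof. by rewrite /gen_lambda -sd_inlM -sd_inrM. Qed.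

Lemma gen_zetaD b b' : gen_zeta (b + b') = (gen_zeta b * gen_zeta b')%g.
Proof. by rewrite /gen_zeta -sd_inrM. Qed.

Lemma gen_h_comm i r z x i' r' z' x' :
  (gen_h i r z x * gen_h i' r' z' x' = gen_h i' r' z' x' * gen_h i r z x)%g.
Proof. by rewrite /gen_h -[LHS]sd_inlM -sd_inlM multC !sd_inlM. Qed.

Lemma gen_h_lambda i r z x a :
  (gen_h i r z x ^ gen_lambda a)%g
  = gen_h i (r * (p i)%:R ^ shift_floor z x a) z (shift_frac z x a).
Proof.
rewrite [LHS]sd_inlJ sdprod_conj; congr (sd_inl _ (sd_inl _ _)).
exact: relabelU.
Qed.

Lemma gen_h_zeta i r z x b : (gen_h i r z x ^ gen_zeta b)%g = gen_h i r (z + b) x.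
Proof.
rewrite [LHS]sdprod_conj; congr (sd_inl _ _); congr pair.
  by apply: val_inj; rewrite /= mul0r.
by rewrite [LHS]relabelU mulr1.
Qed.

Lemma gen_lambda_zeta a b : (gen_lambda a ^ gen_zeta b)%g
  = gen_lambda (dyadicA_pow2M a (- b)).
Proof.
rewrite [LHS]sdprod_conj; congr (sd_inl _ _); congr pair.
by rewrite /relabel msupp0 big_seq_fset0.
Qed.

End G.

(* Main.v *)
Require Import Defs.
From HB Require Import structures.
From mathcomp Require Import all_boot all_order all_algebra.
From mathcomp Require Import finmap monalg reals exp Rstruct ring zify.
From mathcomp Require Import boolp classical_sets functions cardinality.

(** Write K_i for the real field generated over the rationals by all the roots
    p_i^(1/2^k).  As x ranges over the dyadic rationals of [0,1), the real
    numbers p_i^x are a rational basis of K_i ([dyadic_powers_free]), so the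
    map [ev] sending h^{i,r}_{z,x} to r p_i^x identifies H^i_z with K_i; in this
    picture lambda^a multiplies the component (i,z) by p_i^(a 2^z) and zeta
    shifts z ([ev_lam], [ev_zeta]).

    An order of G_n is lexicographic: it looks at the part in Z first, then in
    A, then in P_n.  Indeed, a conjugate of a positive element is positive, and
    for a <> 0 conjugating lambda^a by P_n reaches every element of lambda^a P_n,
    because 1 - p_i^(a 2^z) is invertible in K_i ([sub_lam_onto]); likewise, for
    b <> 0, the conjugates of zeta^b by powers of lambda are cofinal in both
    directions among the zeta^b lambda^c ([cone_G_lex]).  On A and on Z there are
    only two orders each, so everything rests on the orders of the rational
    vector space P_n that are invariant under lambda and zeta.

    Such an order is determined by a sign for each i and by a comparison of the
    components (i,z).  Inside a component, some power of lambda^a multiplies the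
    basis vector h^{i,1}_{z,0} by a rational number, and comparing a root of a
    rational number with rational numbers leaves no choice: up to a global sign
    the order is the one of K_i as a subfield of the reals
    ([root_eigen_compare]).  Two different components have different eigenvalues
    p_i^(2^z), and iterating lambda amplifies their ratio without bound; hence
    one of them is infinitely smaller than the other ([eigen_dominates]).  So an
    element of P_n has the sign of its component in the dominant position
    ([invariant_cone_is_lead_cone]).

    The comparison of components is a total order on pairs (i,z) that is
    invariant under shifting z.  For fixed i and j it amounts to the set of the
    d such that (i,0) precedes (j,d), which is closed upwards or downwards in
    the integers ([comp_order_cut]): countably many possibilities in all.
    Conversely every shift-invariant total order gives an order of G_n
    ([lead_cone_invariant], [lex_cone_G_positive]), and as soon as there are two
    values of i the two corresponding chains of components can be interleaved
    with infinitely many different offsets ([infinite_cones]). *)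

Set Implicit Arguments.
Unset Strict Implicit.
Unset Printing Implicit Defensive.

Import Order.TTheory GRing.Theory Num.Theory.

Local Open Scope classical_set_scope.
Local Open Scope ring_scope.

(** * Orders and positive cones *)

Section Cones.
Variable G : groupType.
Implicit Types (P : set G) (lt : G -> G -> Prop).

Lemma positive_coneP P : is_positive_cone P <->
  [/\ ~ P 1%g, forall a, a <> 1%g -> P a \/ P (a^-1)%g,
      forall a b, P a -> P b -> P (a * b)%g &
      forall g a, P a -> P (g * a * g^-1)%g].
Proof.
split=> [[cov dV d1 dV1 cM cJ]|[n1 tot cM cJ]].
  split=> // [P1|a a1].
    by have : (P `&` [set 1%g]) 1%g by []; rewrite d1.
  have : [set: G] a by [].
  rewrite cov => -[[Pa|[g Pg <-]]|//]; first by left.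
  by right; rewrite invgK.
have PV a : P a -> P (a^-1)%g -> False.
  by move=> Pa PaV; apply: n1; rewrite -(mulgV a); exact: cM.
split=> //.
- apply/seteqP; split=> // a _.
  have [->|/eqP a1] := eqVneq a 1%g; first by right.
  case: (tot a a1) => Pa; left; [by left|right].
  by exists (a^-1)%g; rewrite ?invgK.
- by apply/seteqP; split=> // a [Pa [g Pg ga]]; apply: (PV g); rewrite ?ga.
- by apply/seteqP; split=> // a [Pa a1]; apply: n1; rewrite -a1.
- apply/seteqP; split=> // a [[g Pg <-] /= g1]; apply: n1.
  by rewrite -[1%g]invg1 -g1 invgK.
Qed.

Definition cone_of lt : set G := [set g | lt 1%g g].
Definition order_of P (a b : G) : Prop := P (a^-1 * b)%g.

Lemma cone_of_order lt : is_order lt -> is_positive_cone (cone_of lt).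
Proof.
case=> irr tr tot ml mr; apply/positive_coneP; split.
- exact: irr.
- move=> a a1; case: (tot 1%g a) => [|[/esym//|a_lt]]; first by left.
  by right; rewrite /cone_of /= -(mulVg a) -{2}[(a^-1)%g]mulg1; exact: ml.
- move=> a b la lb; apply: (tr _ a) => //.
  by rewrite -{1}[a]mulg1; exact: ml.
- move=> g a la; rewrite /cone_of /= -(mulgV g); apply: mr.
  by rewrite -{1}[g]mulg1; exact: ml.
Qed.

Lemma order_of_cone P : is_positive_cone P -> is_order (order_of P).
Proof.
move=> /positive_coneP[n1 tot cM cJ]; rewrite /order_of; split.
- by move=> a; rewrite mulVg.
- move=> a b c Pab Pbc.
  by have := cM _ _ Pab Pbc; rewrite -mulgA mulVKg.
- move=> a b; have [->|/eqP ab] := eqVneq a b; first by right; left.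
  have : (a^-1 * b)%g <> 1%g.
    by move/(congr1 ( *%g a)); rewrite mulVKg mulg1 => /esym.
  by case/tot; rewrite ?invgM ?invgK; [left|right; right].
- by move=> a b c; rewrite invgM -mulgA mulKg.
- by move=> a b c /(cJ c^-1%g); rewrite invgK invgM !mulgA.
Qed.

Lemma cone_ofK lt : is_order lt -> order_of (cone_of lt) = lt.
Proof.
case=> _ _ _ ml _; rewrite /order_of /cone_of /=.
apply/funext => a; apply/funext => b; apply/propext; split=> [/(ml _ _ a)|].
  by rewrite mulg1 mulVKg.
by move=> /(ml _ _ a^-1%g); rewrite mulVg.
Qed.

Lemma order_ofK P : cone_of (order_of P) = P.
Proof.
by apply/funext => a; rewrite /cone_of /order_of /= invg1 mul1g.
Qed.

Lemma card_orders : (orders G #= space_of_orders G)%card.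
Proof.
have -> : space_of_orders G = cone_of @` orders G.
  apply/seteqP; split=> [P /order_of_cone Po|_ [lt lto <-]].
    by exists (order_of P); rewrite ?order_ofK.
  exact: cone_of_order.
rewrite card_eq_sym; apply: inj_card_eq => lt lt' /set_mem lto /set_mem lto' E.
by rewrite -[lt]cone_ofK // E cone_ofK.
Qed.

End Cones.

(** * Lexicographic cones on semidirect products *)

Section LexCone.
Variables (K Q : groupType) (phi : K -> Q -> K).
Variable phiP : acts_by_automorphisms phi.
Local Notation S := (sdprod phiP).

Definition lex_cone (PQ : set Q) (PK : set K) : set S :=
  [set x | PQ x.1 \/ x.1 = 1%g /\ PK x.2].

Lemma sd_mulE (x y : S) : (x * y)%g = ((x.1 * y.1)%g, (phi x.2 y.1 * y.2)%g).
Proof. by []. Qed.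
Lemma sd_invE (x : S) : (x^-1)%g = ((x.1^-1)%g, phi (x.2^-1)%g (x.1^-1)%g).
Proof. by []. Qed.

(** The normal subgroup K is convex for such an order; invariance of [PK] under
    the action is what makes conjugation by Q harmless. *)
Lemma lex_cone_positive PQ PK :
  is_positive_cone PQ -> is_positive_cone PK ->
  (forall k q, PK k -> PK (phi k q)) -> is_positive_cone (lex_cone PQ PK).
Proof.
move=> /positive_coneP[q1 qT qM qJ] /positive_coneP[k1 kT kM kJ] kphi.
apply/positive_coneP; split.
- by case=> [|[_]].
- move=> [q k] qk1; rewrite /lex_cone /=.
  have [q_1|/eqP/qT[qq|qq]] := eqVneq q 1%g; [|by left; left|by right; left].
  subst q.
  have /kT[] : k <> 1%g by move=> k_1; apply: qk1; rewrite k_1.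
    by left; right.
  by move=> kV; right; right; rewrite invg1; split=> //; exact: kphi.
- move=> [q k] [q' k']; rewrite /lex_cone /= => -[Pq|[-> Pk]] [Pq'|[-> Pk']].
  + by left; exact: qM.
  + by left; rewrite mulg1.
  + by left; rewrite mul1g.
  + by right; rewrite mulg1; split=> //; apply: kM => //; exact: kphi.
- move=> [g h] [q k]; rewrite /lex_cone /= => -[Pq|[-> Pk]].
    by left; exact: qJ.
  right; rewrite mulg1 mulgV; split=> //.
  rewrite (act1 phiP) (actM phiP).
  have -> : phi h^-1%g g^-1%g = (phi h g^-1)^-1%g.
    by apply: (mulgI (phi h g^-1)); rewrite -(actM phiP) !mulgV (act_id phiP).
  exact/kJ/kphi.
Qed.

Lemma cone_sd_inl C : is_positive_cone C ->
  is_positive_cone [set k | C (sd_inl phiP k)].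
Proof.
move=> /positive_coneP[n1 tot cM cJ].
have inlV k : sd_inl phiP k^-1%g = (sd_inl phiP k)^-1%g.
  by rewrite sd_invE /sd_inl /= invg1 (act1 phiP).
apply/positive_coneP; split=> //.
- move=> a a1; rewrite /= inlV; apply: tot => -[]; exact: a1.
- by move=> a b /= Pa Pb; rewrite sd_inlM; exact: cM.
- by move=> g a /= Pa; rewrite !sd_inlM inlV; exact: cJ.
Qed.

Lemma cone_sd_inr C : is_positive_cone C ->
  is_positive_cone [set q | C (sd_inr phiP q)].
Proof.
move=> /positive_coneP[n1 tot cM cJ].
have inrV q : sd_inr phiP q^-1%g = (sd_inr phiP q)^-1%g.
  by rewrite sd_invE /sd_inr /= invg1 (act_id phiP).
apply/positive_coneP; split=> //.
- move=> a a1; rewrite /= inrV; apply: tot => -[]; exact: a1.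
- by move=> a b /= Pa Pb; rewrite sd_inrM; exact: cM.
- by move=> g a /= Pa; rewrite !sd_inrM inrV; exact: cJ.
Qed.

Lemma cone_sd_phi C k q : is_positive_cone C ->
  C (sd_inl phiP k) -> C (sd_inl phiP (phi k q)).
Proof.
move=> /positive_coneP[_ _ _ cJ] /(cJ (sd_inr phiP q)^-1%g).
by rewrite invgK -mulgA -(sdprod_conj phiP).
Qed.

(** The pair (q, phi k q k^-1) is the conjugate of q by k.  As k varies these
    conjugates spread over the coset q K, which is how K is shown to be
    negligible before q. *)
Lemma cone_conj_inr C k q : is_positive_cone C ->
  C (sd_inr phiP q) -> C (q, (phi k q * k^-1)%g).
Proof.
move=> /positive_coneP[_ _ _ cJ] /(cJ (sd_inl phiP k)).
set x := (X in C X); suff -> : x = (q, (phi k q * k^-1)%g) by [].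
rewrite /x sd_invE !sd_mulE /= invg1 mul1g !mulg1.
by rewrite !(act1 phiP).
Qed.

(** If the sign of q decides the sign of the whole coset q K for each q <> 1, the
    sign of an arbitrary element is read on its Q-part first. *)
Lemma cone_lex C : is_positive_cone C ->
  (forall q k, q <> 1%g -> C (sd_inr phiP q) -> C (q, k)) ->
  C = lex_cone [set q | C (sd_inr phiP q)] [set k | C (sd_inl phiP k)].
Proof.
move=> Cc conv; have /positive_coneP[n1 tot cM _] := Cc.
have CP x : C x -> lex_cone [set q | C (sd_inr phiP q)]
    [set k | C (sd_inl phiP k)] x.
  case: x => q k Cx; rewrite /lex_cone /=.
  have [q1|/eqP q1] := eqVneq q 1%g; first by right; rewrite q1 in Cx *.
  left; have /positive_coneP[_ /(_ q q1)/= + _ _] := cone_sd_inr Cc.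
  case=> // CV; exfalso; apply: n1.
  have qV1 : q^-1%g <> 1%g by move/eqP; rewrite invg_eq1 => /eqP.
  (* (q^-1, phi k^-1 q^-1) is the inverse of (q, k). *)
  have := cM _ _ Cx (conv _ (phi k^-1 q^-1)%g qV1 CV).
  by rewrite sd_mulE /= mulgV -(actM phiP) mulgV (act_id phiP).
apply/seteqP; split=> // -[q k] [/= Cq|[/= -> //]].
by apply: conv => // q1; apply: n1; rewrite q1 in Cq.
Qed.

End LexCone.

Arguments lex_cone {K Q phi} phiP PQ PK.

(** * Linear independence of the dyadic powers of a prime *)

Section Pow.
Variables (R : realType) (q : nat).
Hypothesis q_prime : prime q.

(** Eisenstein's criterion at q. *)
Lemma irreducible_XnsubC (N : nat) : (0 < N)%N ->
  irreducible_poly ('X^N - (q%:R)%:P : {poly rat}).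
Proof.
move=> N0; pose r : {poly int} := 'X^N - (q%:Z)%:P.
have sz : size r = N.+1 by rewrite size_XnsubC.
have -> : 'X^N - (q%:R)%:P = map_poly intr r :> {poly rat}.
  by rewrite rmorphB /= map_polyXn map_polyC.
apply/irreducible_rat_int; apply: (@eisenstein_crit q) => //.
- by rewrite sz eqSS -lt0n.
- rewrite lead_coefE sz /= coefB coefXn eqxx coefC -[(_ == 0)%N]negbK -lt0n N0 /=.
  rewrite subr0 dvdzE /= dvdn1; by apply: contraTneq q_prime => ->.
- rewrite coefB coefXn coefC eq_sym -[(_ == 0)%N]negbK -lt0n N0 /= sub0r.
  rewrite dvdzE abszN /= natrXE gtnNdvd ?prime_gt0 //.
  by rewrite ltn_Pmulr ?prime_gt0 ?prime_gt1.
- move=> i; rewrite sz /= coefB coefXn => iN; rewrite (ltn_eqF iN) /= sub0r.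
  rewrite dvdzE abszN coefC; case: ifP => //= _; exact: dvdn0.
Qed.

(** A nonzero f of degree less than N vanishing at t = q^(1/N) would share the
    root t, hence a nonconstant factor, with the irreducible X^N - q. *)
Lemma poly_root_eq0 (N : nat) (t : R) (f : {poly rat}) : (0 < N)%N ->
  t ^+ N = q%:R -> (size f <= N)%N -> (map_poly ratr f).[t] = 0 -> f = 0.
Proof.
move=> N0 tN szf ft; apply/eqP/negPn/negP => f0.
have [_ irr] := irreducible_XnsubC N0.
set g := gcdp f ('X^N - (q%:R)%:P).
have gt0 : root (map_poly ratr g : {poly R}) t.
  rewrite gcdp_map root_gcd; apply/andP; split; first exact/eqP.
  rewrite rmorphB /= map_polyXn map_polyC /= ratr_nat.
  by rewrite rootE hornerD hornerN hornerXn hornerC tN subrr.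
have sg : size g != 1.
  apply/negP => /size_poly1P[c c0 gc]; move: gt0.
  by rewrite gc map_polyC rootC /= fmorph_eq0 (negbTE c0).
have := irr g sg (dvdp_gcdr _ _) => /eqp_size; rewrite size_XnsubC // => szg.
have := dvdp_leq f0 (dvdp_gcdl f ('X^N - (q%:R)%:P)).
by rewrite -/g szg leqNgt ltnS szf.
Qed.

Lemma dyadic_common_den (s : seq rat) : {subset s <= dyadic} ->
  exists2 N, (0 < N)%N & forall x, x \in s -> exists m : int, x * N%:R = m%:~R.
Proof.
elim: s => [|x s IHs] sD; first by exists 1.
have [|N N0 sN] := IHs; first by move=> y ys; apply: sD; rewrite inE ys orbT.
have /asboolP[m [k xE]] := sD x (mem_head _ _).
exists (2 ^ `|k| * N)%N; first by rewrite muln_gt0 expn_gt0.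
move=> y; rewrite inE => /orP[/eqP->|/sN[m' yE]].
  case: k xE => k xE.
    exists (m * N%:Z); rewrite xE natrM natrX rmorphM /=.
    by rewrite mulrA divfK ?expf_neq0.
  exists (m * (2 ^ k.+1)%N * (2 ^ k.+1)%N * N%:Z).
  have -> : x = m%:~R * 2 ^+ k.+1 by rewrite xE -[2 ^ Negz k]/(2 ^- k.+1) invrK.
  by rewrite -natrX natrM !rmorphM /= !mulrA.
by exists (m' * (2 ^ `|k|)%N%:Z); rewrite natrM mulrCA yE rmorphM /= mulrC.
Qed.

(** Over a common denominator N, the sum is the value at q^(1/N) of a polynomial
    of degree less than N whose coefficients are the [r i]. *)
Lemma dyadic_powers_free (I : eqType) (s : seq I) (x r : I -> rat) :
  uniq s -> {in s &, injective x} ->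
  (forall i, i \in s -> (x i \in dyadic) && (0 <= x i < 1)) ->
  \sum_(i <- s) ratr (r i) * q%:R `^ ratr (x i) = 0 :> R ->
  forall i, i \in s -> r i = 0.
Proof.
move=> us xinj xs sum0 i0 i0s.
have [|N N0 Nx] := @dyadic_common_den (map x s).
  by move=> _ /mapP[i /xs/andP[xD _] ->].
have /all_sig2[e eN eE] i : {e : nat | i \in s -> (e < N)%N &
    i \in s -> x i * N%:R = e%:R}.
  apply: cid2; have [iS|] := boolP (i \in s); last by exists 0%N.
  have [m mE] := Nx _ (map_f x iS); have /and3P[_ x0 x1] := xs _ iS.
  have m0 : 0 <= m by rewrite -(ler0z rat) -mE mulr_ge0.
  exists `|m|%N => _; last by rewrite mE -[m in LHS]gez0_abs.
  rewrite -ltz_nat gez0_abs // -(ltr_int rat) -mE.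
  by rewrite -[ltRHS]mul1r ltr_pM2r // ltr0n.
pose t : R := q%:R `^ (N%:R)^-1.
have tN : t ^+ N = q%:R.
  by rewrite -powR_mulrn ?powR_ge0 // -powRrM mulVf ?powRr1 // pnatr_eq0 -lt0n.
have tE i : i \in s -> q%:R `^ ratr (x i) = t ^+ e i.
  move=> iS; rewrite -powR_mulrn ?powR_ge0 // -powRrM; congr (_ `^ _).
  have -> : x i = (e i)%:R / N%:R by rewrite -eE // mulfK // pnatr_eq0 -lt0n.
  by rewrite fmorph_div /= !ratr_nat mulrC.
(* The exponents e i = N x_i are distinct, so no two terms of f interfere. *)
pose f : {poly rat} := \sum_(i <- s) r i *: 'X^(e i).
have f0 : f = 0.
  apply: (@poly_root_eq0 N t) => //.
    rewrite /f big_seq; apply: (big_ind (fun f : {poly rat} => size f <= N)%N).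
    - by rewrite size_poly0.
    - by move=> g h gN hN; rewrite (leq_trans (size_polyD _ _)) // geq_max gN.
    - move=> i iS; rewrite (leq_trans (size_scale_leq _ _)) // size_polyXn.
      exact: eN.
  rewrite -[RHS]sum0 rmorph_sum horner_sum big_seq [RHS]big_seq.
  apply: eq_bigr => i iS; rewrite tE // -mul_polyC rmorphM /= map_polyC map_polyXn.
  by rewrite hornerM hornerC hornerXn.
have := congr1 (fun f : {poly rat} => f`_(e i0)) f0.
rewrite coef0 coef_sum (bigD1_seq i0) //= coefZ coefXn eqxx mulr1 => <-.
rewrite big_seq_cond big1 ?addr0 // => i /andP[iS ii0].
rewrite coefZ coefXn; case: eqP => [ei|]; last by rewrite mulr0.
case/eqP: ii0; apply: xinj => //.
have : x i * N%:R = x i0 * N%:R by rewrite !eE ?ei.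
by apply: mulIf; rewrite pnatr_eq0 -lt0n.
Qed.

End Pow.

(** * Linear maps on direct sums of copies of the rationals *)

Section RelabelLinear.
Variable K : choiceType.

Lemma relabelZ c s (r : rat) (f : {malg rat[K]}) :
  relabel c s (r *: f) = r *: relabel c s f.
Proof.
rewrite (relabelEw _ _ (msuppZ_le r f)) scaler_sumr; apply: eq_bigr => k _.
by rewrite mcoeffZ; apply/malgP => k'; rewrite mcoeffZ !mcoeffU -mulrA mulrnAr.
Qed.

HB.instance Definition _ c s := GRing.isLinear.Build rat {malg rat[K]}
  {malg rat[K]} _ (relabel c s) (fun r f g => etrans (relabelD c s (r *: f) g)
    (congr1 (fun h => h + relabel c s g) (relabelZ c s r f))).

Lemma scale_monalgU (r r' : rat) (k : K) : r *: << r' *g k >> = << r * r' *g k >>.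
Proof. by apply/malgP => k'; rewrite mcoeffZ !mcoeffU mulrnAr. Qed.

Variable R : realType.

Definition lin_ext (w : K -> R) (f : {malg rat[K]}) : R :=
  \sum_(k <- msupp f) ratr f@_k * w k.

Lemma lin_extEw (d : {fset K}) w f : (msupp f `<=` d)%fset ->
  lin_ext w f = \sum_(k <- d) ratr f@_k * w k.
Proof.
move=> fd; rewrite /lin_ext (big_fset_incl _ fd) // => k _ /mcoeff_outdom ->.
by rewrite rmorph0 mul0r.
Qed.

Lemma lin_extD w : {morph lin_ext w : f g / f + g}.
Proof.
move=> f g; pose d := (msupp f `|` msupp g)%fset.
rewrite (@lin_extEw d _ (f + g)) ?msuppD_le //.
rewrite (@lin_extEw d _ f) ?fsubsetUl // (@lin_extEw d _ g) ?fsubsetUr //.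
rewrite -big_split /=; apply: eq_bigr => k _.
by rewrite mcoeffD rmorphD mulrDl.
Qed.

Lemma lin_extZ w r f : lin_ext w (r *: f) = ratr r * lin_ext w f.
Proof.
rewrite (lin_extEw _ (msuppZ_le r f)) mulr_sumr; apply: eq_bigr => k _.
by rewrite mcoeffZ rmorphM mulrA.
Qed.

Lemma lin_extN w : {morph lin_ext w : f / - f}.
Proof. by move=> f; rewrite -scaleN1r lin_extZ rmorphN1 mulN1r. Qed.

Lemma lin_ext0 w : lin_ext w 0 = 0.
Proof. by rewrite -(scale0r (0 : {malg rat[K]})) lin_extZ rmorph0 mul0r. Qed.

Lemma lin_extU w k r : lin_ext w << r *g k >> = ratr r * w k.
Proof.
by rewrite (@lin_extEw [fset k]%fset) ?msuppU_le // big_seq_fset1 mcoeffUU.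
Qed.

Lemma lin_ext_sum w (I : Type) (l : seq I) (F : I -> {malg rat[K]}) :
  lin_ext w (\sum_(i <- l) F i) = \sum_(i <- l) lin_ext w (F i).
Proof. exact: (big_morph _ (lin_extD w) (lin_ext0 w)). Qed.

Lemma lin_ext_relabel w c s f :
  lin_ext w (relabel c s f) = lin_ext (fun k => ratr (c k) * w (s k)) f.
Proof.
rewrite /relabel lin_ext_sum; apply: eq_bigr => k _.
by rewrite lin_extU rmorphM mulrA.
Qed.

End RelabelLinear.

(** * Invariant cones given by a dominant component *)

Lemma seq_max (T : eqType) (prec : T -> T -> Prop) (s : seq T) :
  (forall x y z, prec x y -> prec y z -> prec x z) ->
  (forall x y, prec x y \/ x = y \/ prec y x) ->
  s <> [::] -> exists2 m, m \in s & forall x, x \in s -> x = m \/ prec x m.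
Proof.
move=> tr tot; elim: s => // x [|y s] IHs _.
  exists x; first exact: mem_head.
  by move=> y; rewrite inE => /eqP; left.
have [//|m ms mmax] := IHs.
case: (tot x m) => [xm|[xm|mx]].
- exists m; first by rewrite inE ms orbT.
  by move=> z; rewrite inE => /orP[/eqP->|/mmax//]; right.
- exists m; first by rewrite inE ms orbT.
  by move=> z; rewrite inE => /orP[/eqP->|/mmax//]; left.
- exists x; first exact: mem_head.
  move=> z; rewrite inE => /orP[/eqP->|/mmax[->|zm]]; [by left|by right|].
  by right; exact: tr mx.
Qed.

(** The positive cones of an abelian group written additively: closure under
    conjugation says nothing there. *)
Record vector_cone (V : zmodType) (pos : set V) : Prop := VectorCone {
  vcone0 : ~ pos 0;
  vconeD : forall f g, pos f -> pos g -> pos (f + g);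
  vcone_total : forall f, f <> 0 -> pos f \/ pos (- f) }.

Section Lead.
Variables (R : realType) (n : nat) (p : 'I_n -> nat).
Hypothesis p_prime : forall i, prime (p i).

Local Notation V := {malg rat[idx n]}.
Local Notation comp := ('I_n * int)%type.
Implicit Types (f g : V) (c d : comp).

Definition lam (a : dyadicA) (f : V) : V :=
  relabel (lam_coef p a) (lam_idx a) f.

Definition zeta (b : int) (f : V) : V := relabel (fun=> 1) (@zeta_idx n b) f.

HB.instance Definition _ a :=
  GRing.Linear.copy (lam a) (relabel (lam_coef p a) (lam_idx a)).
HB.instance Definition _ b :=
  GRing.Linear.copy (zeta b) (relabel (fun=> 1) (@zeta_idx n b)).

Lemma lam_0 f : lam 0 f = f. Proof. exact: act1 (lam_actP p_prime) f. Qed.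

Lemma lam_add a b f : lam (a + b) f = lam b (lam a f).
Proof. exact: (actA (lam_actP p_prime) a b f). Qed.

Lemma lamZ a r f : lam a (r *: f) = r *: lam a f.
Proof. exact: linearZ. Qed.

Lemma zetaZ b r f : zeta b (r *: f) = r *: zeta b f.
Proof. exact: linearZ. Qed.

Lemma lamU a i z x (r : rat) : lam a << r *g (i, z, x) >>
  = << r * (p i)%:R ^ shift_floor z x a *g (i, z, shift_frac z x a) >>.
Proof. exact: relabelU. Qed.

Lemma zetaU b i z x (r : rat) :
  zeta b << r *g (i, z, x) >> = << r *g (i, z + b, x) >>.
Proof. by rewrite /zeta relabelU mulr1. Qed.

(** Together with [ev]: the projection of P_n onto its component c = (i,z),
    followed by the embedding of H^i_z in the reals that sends the basis vector
    of index x to p_i^x. *)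
Definition weight c (k : idx n) : R :=
  if k.1 == c then (p c.1)%:R `^ ratr (val k.2) else 0.

Definition ev c f : R := lin_ext (weight c) f.

Lemma evD c : {morph ev c : f g / f + g}. Proof. exact: lin_extD. Qed.
Lemma evN c : {morph ev c : f / - f}. Proof. exact: lin_extN. Qed.
Lemma ev0 c : ev c 0 = 0. Proof. exact: lin_ext0. Qed.

Lemma p_neq0 i : (p i)%:R != 0 :> R.
Proof. by rewrite pnatr_eq0 -lt0n prime_gt0. Qed.

(** The carry of x + a 2^z beyond 1 is an integer m, and the factor p_i^m in the
    action of lambda^a is exactly what is needed for p_i^x to be multiplied by
    p_i^(a 2^z). *)
Lemma ev_lam c f (a : dyadicA) :
  ev c (lam a f) = (p c.1)%:R `^ ratr ((a : rat) * 2 ^ c.2) * ev c f.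
Proof.
rewrite /ev /lam lin_ext_relabel /lin_ext mulr_sumr.
apply: eq_bigr => -[[i z] x] _; rewrite [RHS]mulrCA; congr (_ * _).
rewrite /weight /=; case: ((i, z) =P c) => [<-/=|_]; last by rewrite !mulr0.
rewrite fmorphXz /= ratr_nat -powR_intmul ?ler0n // -!powRD ?p_neq0 ?implybT //.
congr (_ `^ _); rewrite -ratr_int -!rmorphD /=; congr ratr.
by rewrite addrCA subrr addr0 addrC.
Qed.

Lemma ev_zeta c f b :
  ev (c.1, c.2 + b) (zeta b f) = ev c f.
Proof.
rewrite /ev /zeta lin_ext_relabel; apply: eq_bigr => -[[i z] x] _.
rewrite /weight /= rmorph1 mul1r; congr (_ * _).
by rewrite -![in LHS]pair_eqE /= -[in RHS]pair_eqE /= (inj_eq (addIr b)).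
Qed.

(** The embedding of a component is injective, by linear independence of the
    dyadic powers of p_i. *)
Lemma ev_eq0 c f : ev c f = 0 -> forall x, f@_(c, x) = 0.
Proof.
move=> fc0 x; have [xf|/mcoeff_outdom//] := boolP ((c, x) \in msupp f).
pose s := [seq k <- msupp f | k.1 == c].
apply: (@dyadic_powers_free R (p c.1) (p_prime c.1) _ s (fun k => val k.2)
  (fun k => f@_k)); rewrite ?filter_uniq ?fset_uniq //.
- move=> [d y] [d' y']; rewrite !mem_filter /= => /andP[/eqP-> _] /andP[/eqP-> _].
  by move/val_inj => ->.
- by move=> [d y] _; exact: valP y.
- rewrite -[RHS]fc0 big_filter big_mkcond; apply: eq_bigr => -[d y] _.
  by rewrite /weight /=; case: eqP => // _; rewrite mulr0.
- by rewrite mem_filter eqxx.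
Qed.

(** The elements whose component at the [prec]-greatest place where they do not
    vanish is positive, after correction by the sign that [sg] attaches to that
    place ([true] stands for a minus sign). *)
Definition lead_cone (sg : 'I_n -> bool) (prec : comp -> comp -> Prop) : set V :=
  [set f | exists c, 0 < (-1) ^+ sg c.1 * ev c f /\
                     forall d, prec c d -> ev d f = 0].

(** The shift of the second coordinate is the effect of zeta on components. *)
Record comp_order (prec : comp -> comp -> Prop) : Prop := CompOrder {
  comp_irr : forall c, ~ prec c c;
  comp_trans : forall c d e, prec c d -> prec d e -> prec c e;
  comp_total : forall c d, prec c d \/ c = d \/ prec d c;
  comp_shift : forall c d b, prec c d -> prec (c.1, c.2 + b) (d.1, d.2 + b) }.

(** The cones of P_n that are closed under conjugation by all of G_n. *)
Record invariant_cone (pos : set V) : Prop := InvariantCone {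
  inv_vcone :> vector_cone pos;
  inv_cone_lam : forall f a, pos f -> pos (lam a f);
  inv_cone_zeta : forall f b, pos f -> pos (zeta b f) }.

Section LeadCone.
Variables (sg : 'I_n -> bool) (prec : comp -> comp -> Prop).
Hypothesis precP : comp_order prec.

Lemma lead_cone_total f : f <> 0 -> lead_cone sg prec f \/ lead_cone sg prec (- f).
Proof.
move=> f0; have [_ tr tot _] := precP.
pose s := [seq k.1 | k <- msupp f].
pose s' := [seq c <- s | ev c f != 0].
(* By [ev_eq0] some component of f does not vanish. *)
have [|m ms mmax] := @seq_max _ prec s' tr tot.
  move=> s'0; apply: f0; apply/malgP => -[c x]; rewrite mcoeff0.
  have [xf|/mcoeff_outdom//] := boolP ((c, x) \in msupp f).
  apply: ev_eq0; apply/eqP/negPn/negP => ec.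
  suff: c \in s' by rewrite s'0.
  by rewrite mem_filter ec; apply/mapP; exists (c, x).
have above d : prec m d -> ev d f = 0.
  move=> md; apply/eqP/negPn/negP => ed.
  have ds : d \in s'.
    rewrite mem_filter ed; apply/negPn/negP => /mapP ds.
    move/eqP: ed; apply; rewrite /ev /lin_ext big_seq big1 // => k kf.
    rewrite /weight; case: eqP => [kd|]; last by rewrite mulr0.
    by case: ds; exists k.
  case: (mmax d ds) => [dm|/(tr _ _ _ md)]; last exact: (comp_irr precP).
  by move: md; rewrite dm; exact: (comp_irr precP).
have : (-1) ^+ sg m.1 * ev m f != 0.
  by move: ms; rewrite mem_filter => /andP[? _]; rewrite mulf_neq0 ?signr_eq0.
rewrite neq_lt => /orP[neg|pos]; [right|left]; exists m; split=> //.
  by rewrite evN mulrN oppr_gt0.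
by move=> d /above; rewrite evN => ->; rewrite oppr0.
Qed.

(** lambda multiplies each component by a positive real number, so it preserves
    both the dominant place and its sign; zeta moves the dominant place along. *)
Lemma lead_cone_invariant : invariant_cone (lead_cone sg prec).
Proof.
have [irr tr tot sh] := precP; split; first split.
- by case=> c []; rewrite ev0 mulr0 ltxx.
- move=> f g [c [fc fc0]] [d [gd gd0]].
  case: (tot c d) => [cd|[cd|dc]].
  + exists d; split=> [|e de]; first by rewrite evD fc0 // add0r.
    by rewrite evD fc0 ?gd0 ?addr0 //; exact: tr de.
  + subst d; exists c; split=> [|e ce]; first by rewrite evD mulrDr addr_gt0.
    by rewrite evD fc0 // gd0 // addr0.
  + exists c; split=> [|e ce]; first by rewrite evD gd0 // addr0.
    by rewrite evD fc0 ?gd0 ?addr0 //; exact: tr ce.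
- exact: lead_cone_total.
- move=> f a [c [fc fc0]]; exists c; split=> [|d cd].
    by rewrite ev_lam mulrCA mulr_gt0 // powR_gt0 // lt0r p_neq0 ler0n.
  by rewrite ev_lam fc0 // mulr0.
- move=> f b [c [fc fc0]]; exists (c.1, c.2 + b); split=> [|[j w] cd].
    by rewrite ev_zeta.
  have -> : w = (w - b) + b by rewrite subrK.
  rewrite (ev_zeta (j, w - b)); apply: fc0; move: (sh _ _ (- b) cd) => /=.
  by rewrite addrK -surjective_pairing.
Qed.

End LeadCone.
End Lead.

(** * Comparisons in ordered rational vector spaces *)

Lemma prime_expn_inj p q a b : prime p -> prime q -> (0 < a)%N ->
  (p ^ a = q ^ b)%N -> p = q /\ a = b.
Proof.
move=> pp qp a0 pq; have : (p %| q ^ b)%N by rewrite -pq dvdn_exp.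
rewrite Euclid_dvdX // dvdn_prime2 // => /andP[/eqP pE _]; split=> //.
by move: pq; rewrite -pE => /eqP; rewrite eqn_exp2l ?prime_gt1 // => /eqP.
Qed.

(** Bernoulli's inequality. *)
Lemma exprn_unbounded (F : archiRealFieldType) (r N : F) : 1 < r ->
  exists m, N <= r ^+ m.
Proof.
move=> r1; have bern m : 1 + (r - 1) * m%:R <= r ^+ m.
  elim: m => [|m IHm]; first by rewrite mulr0 addr0.
  rewrite exprSr (le_trans _ (ler_wpM2r _ IHm)) ?(le_trans ler01 (ltW r1)) //.
  rewrite -subr_ge0.
  have -> : (1 + (r - 1) * m%:R) * r - (1 + (r - 1) * m.+1%:R)
    = (r - 1) ^+ 2 * m%:R by rewrite -addn1 natrD; ring.
  by rewrite mulr_ge0 ?sqr_ge0.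
pose t := N / (r - 1); exists (Num.trunc t).+1; apply: le_trans (bern _).
have d0 : 0 < r - 1 by rewrite subr_gt0.
rewrite ler_wpDl // -[N](@divfK _ (r - 1)) ?gt_eqF // mulrC ler_pM2l //.
exact/ltW/truncnS_gt.
Qed.

Lemma exprz_unbounded (F : archiRealFieldType) (r N : F) : 0 < r -> r != 1 ->
  exists m : int, N <= r ^ m.
Proof.
move=> r0; rewrite neq_lt => /orP[r1|/(exprn_unbounded N)[m mN]]; last first.
  by exists m.
have [|m mN] := @exprn_unbounded _ r^-1 N; first by rewrite invf_gt1.
by exists (- m%:Z); rewrite -exprz_inv.
Qed.

Lemma pos_rat_frac (r : rat) : 0 < r ->
  exists num den : nat, num.+1%:R = r * den.+1%:R.
Proof.
move=> r0; move: (numqE r).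
have : 0 < numq r by rewrite numq_gt0.
have := denq_gt0 r.
case: (denq r) => // -[//|den] _; case: (numq r) => // -[//|num] _.
by exists num, den.
Qed.

Section VectorCone.
Variables (R : realType) (V : lmodType rat) (pos : set V).
Hypothesis posP : vector_cone pos.
Implicit Types (f g h : V) (r q : rat).

Let posD f g : pos f -> pos g -> pos (f + g).
Proof. exact: vconeD posP _ _. Qed.

Lemma pos_anti f : pos f -> pos (- f) -> False.
Proof. by move=> /posD/[apply]; rewrite subrr; exact: vcone0 posP. Qed.

(** A group order on a rational vector space is compatible with scaling: if r f
    were negative, so would be its multiple by the denominator of r, which is a
    positive multiple of f. *)
Lemma posZ r f : 0 < r -> pos f -> pos (r *: f).
Proof.
move=> r0 pf.
have posMn g m : pos g -> pos (g *+ m.+1).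
  move=> pg; elim: m => // m IHm; rewrite mulrS; exact: posD.
have rf0 : r *: f <> 0.
  move/eqP; rewrite scaler_eq0 gt_eqF //= => /eqP f0.
  by move: pf; rewrite f0; exact: vcone0 posP.
case: (vcone_total posP rf0) => // nrf; exfalso.
have [num [den numE]] := pos_rat_frac r0.
apply: (@pos_anti (f *+ num.+1)); first exact: posMn.
suff -> : f *+ num.+1 = (r *: f) *+ den.+1 by rewrite -mulNrn; exact: posMn.
rewrite -[LHS]scaler_nat -[RHS]scaler_nat scalerA; congr (_ *: _).
by rewrite numE mulrC.
Qed.

Definition nonneg f := f = 0 \/ pos f.

Lemma nonnegD f g : nonneg f -> nonneg g -> nonneg (f + g).
Proof.
move=> [->|pf] [->|pg]; rewrite ?add0r ?addr0; [by left|by right|by right|].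
by right; exact: posD.
Qed.

Lemma pos_nonneg f g : pos f -> nonneg g -> pos (f + g).
Proof. by move=> pf [->|/(posD pf)//]; rewrite addr0. Qed.

Lemma nonnegZ r f : 0 <= r -> nonneg f -> nonneg (r *: f).
Proof.
rewrite le_eqVlt => /orP[/eqP<- _|r0]; first by left; rewrite scale0r.
by case=> [->|pf]; [left; rewrite scaler0|right; exact: posZ].
Qed.

Lemma nonnegVpos f : nonneg f \/ pos (- f).
Proof.
have [->|/eqP f0] := eqVneq f 0; first by left; left.
by case: (vcone_total posP f0); [left; right|right].
Qed.

Lemma nonneg_anti f : nonneg f -> pos (- f) -> False.
Proof.
case=> [->|]; last exact: pos_anti.
by rewrite oppr0; exact: vcone0 posP.
Qed.

Lemma scale_subE r q f g : r != 0 ->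
  r *: g - q *: f = - (r *: ((q / r) *: f - g)).
Proof. by move=> r0; rewrite scalerBr scalerA mulrC divfK // opprB. Qed.

Lemma pos_sub_ratio f g r q N : 0 < q -> N <= r / q -> pos f ->
  pos (q *: g - r *: f) -> pos (g - N *: f).
Proof.
move=> q0 Nrq pf pgf.
have -> : g - N *: f = q^-1 *: (q *: g - r *: f) + (r / q - N) *: f.
  rewrite scalerBr !scalerA mulVf ?gt_eqF // scale1r scalerBl addrA.
  by rewrite [q^-1 * r]mulrC subrK.
apply: pos_nonneg; first by apply: posZ; rewrite ?invr_gt0.
by apply: nonnegZ; [rewrite subr_ge0|right].
Qed.

(** The bounds f > q' g and h > (q'/q) g combine, since -q > 0. *)
Lemma pos_sub_trans f g h q q' : q < 0 ->
  pos (f - q' *: g) -> pos (h - (q' / q) *: g) -> pos (f - q *: h).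
Proof.
move=> q0 pfg phg.
have -> : f - q *: h = f - q' *: g + (- q) *: (h - (q' / q) *: g).
  rewrite scalerBr scalerA mulNr mulrCA divff ?lt_eqF // mulr1.
  by rewrite !scaleNr opprK addrCA addrC subrK.
by apply: posD => //; apply: posZ; rewrite ?oppr_gt0.
Qed.

(** A comparison of T f with q f, in the sense given by the sign of e, propagates
    to T^k f and q^k f, because T preserves positivity and commutes with
    scaling. *)
Lemma nonneg_iter (T : {linear V -> V}) f e q k :
  (forall g, pos g -> pos (T g)) -> 0 < q ->
  nonneg (e *: (q *: f - T f)) -> nonneg (e *: (q ^+ k *: f - iter k T f)).
Proof.
move=> posT q0 base; elim: k => [|k IHk].
  by left; rewrite scale1r subrr scaler0.
have -> : q ^+ k.+1 *: f - iter k.+1 T f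
  = q ^+ k *: (q *: f - T f) + T (q ^+ k *: f - iter k T f).
  by rewrite scalerBr linearB [T (_ *: _)]linearZ /= scalerA -exprSr addrA subrK.
rewrite scalerDr; apply: nonnegD.
  by rewrite scalerA mulrC -scalerA; apply: nonnegZ => //; exact/exprn_ge0/ltW.
rewrite -linearZ /=; case: IHk => [->|/posT]; last by right.
by left; rewrite linear0.
Qed.

(** Applying T to f < g gives a f < b g; if a / b is large, f is much smaller
    than g. *)
Lemma eigen_dominates (T : {linear V -> V}) f g a b N :
  (forall h, pos h -> pos (T h)) -> pos f -> pos (g - f) ->
  T f = a *: f -> T g = b *: g -> 0 < b -> N <= a / b -> pos (g - N *: f).
Proof.
move=> posT pf pgf Tf Tg b0 Nab; apply: (pos_sub_ratio b0 Nab pf).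
by rewrite -Tf -Tg -linearB; exact: posT.
Qed.

(** If T^N multiplies f by m, then T f compares with rational multiples of f as
    the real number t = m^(1/N) does: were T f on the wrong side of (q / r) f,
    iteration would put m f on the wrong side of (q / r)^N f.  The coefficient r
    has either sign, so that lower and upper bounds are treated together. *)
Lemma root_eigen_compare (T : {linear V -> V}) f N (m : rat) (t : R) r q :
  (forall h, pos h -> pos (T h)) -> pos f -> (0 < N)%N ->
  iter N T f = m *: f -> 0 < t -> t ^+ N = ratr m ->
  ratr q < ratr r * t -> pos (r *: T f - q *: f).
Proof.
move=> posT pf N0 TN t0 tN qrt.
have [r0|r0] := eqVneq r 0.
  rewrite r0 scale0r add0r -scaleNr; apply: posZ => //.
  by move: qrt; rewrite r0 rmorph0 mul0r ltrq0 oppr_gt0.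
have [q0|q0] := lerP (q / r) 0.
  have r_gt0 : 0 < r.
    rewrite lt0r r0 /=; apply: contraTT qrt; rewrite -ltNge -leNgt => r_lt0.
    apply: (@le_trans _ _ 0); first by rewrite ltW // pmulr_llt0 // ltrq0.
    by move: q0; rewrite ler_ndivrMr // mul0r ler0q.
  apply: pos_nonneg; first by apply: posZ => //; exact: posT.
  rewrite -scaleNr; apply: nonnegZ; last by right.
  by rewrite oppr_ge0; move: q0; rewrite pmulr_lle0 ?invr_gt0.
rewrite scale_subE //.
case: (nonnegVpos (r *: ((q / r) *: f - T f))) => [base|//]; exfalso.
have := nonneg_iter N posT q0 base; rewrite TN -scalerBl scalerA => nn.
have lt_pow : 0 < r * (m - (q / r) ^+ N).
  have [rneg|rpos|/eqP] := ltgtP r 0; last by rewrite (negbTE r0).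
    rewrite nmulr_rgt0 // subr_lt0 -(ltr_rat R) rmorphXn /= -tN.
    rewrite ltrXn2r -?lt0n ?ler0q ?(ltW t0) ?(ltW q0) //.
    by rewrite fmorph_div /= ltr_ndivlMr ?ltrq0 // mulrC.
  rewrite pmulr_rgt0 // subr_gt0 -(ltr_rat R) rmorphXn /= -tN.
  rewrite ltrXn2r -?lt0n ?ler0q ?(ltW t0) ?(ltW q0) //.
  by rewrite fmorph_div /= ltr_pdivrMr ?ltr0q // mulrC.
apply: (nonneg_anti nn); rewrite -scaleNr; apply: posZ => //.
by rewrite -mulrN opprB.
Qed.

(** The geometric sum of the T^k f inverts 1 - T up to the factor 1 - m. *)
Lemma telescope_onto (T : {linear V -> V}) f N (m : rat) :
  iter N T f = m *: f -> m != 1 -> exists g, g - T g = f.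
Proof.
move=> TN m1; exists ((1 - m)^-1 *: \sum_(k < N) iter k T f).
have m10 : 1 - m != 0 by rewrite subr_eq0 eq_sym.
rewrite linearZ /= -scalerBr linear_sum /= -sumrB.
have -> : \sum_(k < N) (iter k T f - iter k.+1 T f) = f - iter N T f.
  elim: N {TN} => [|N IHN]; first by rewrite big_ord0 subrr.
  by rewrite big_ord_recr /= IHN addrA subrK.
rewrite TN -[X in _ *: (X - _)]scale1r -scalerBl.
by rewrite scalerA mulVf // scale1r.
Qed.

(** If each vector F i lies above q h for all rational q below the real number
    v i, the same holds for the sums: by density a rational number below the sum
    of the v i splits into rational numbers below each term. *)
Lemma sum_lower_bound (I : eqType) (s : seq I) (F : I -> V) (v : I -> R) h :
  pos h ->
  (forall i q, i \in s -> ratr q < v i -> pos (F i - q *: h)) ->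
  forall q, ratr q < \sum_(i <- s) v i -> pos (\sum_(i <- s) F i - q *: h).
Proof.
move=> ph; elim: s => [_ q|i s IHs Fv q].
  rewrite !big_nil ltrq0 => q0.
  by rewrite add0r -scaleNr; apply: posZ; rewrite ?oppr_gt0.
rewrite !big_cons -ltrBlDr => /rat_in_itvoo[q1].
rewrite in_itv /= => /andP[q1l q1r].
have -> : F i + \sum_(j <- s) F j - q *: h
  = (F i - q1 *: h) + (\sum_(j <- s) F j - (q - q1) *: h).
  rewrite scalerBl opprB addrACA; congr (_ + _).
  by rewrite addrA addNr add0r.
apply: posD; first by apply: Fv => //; exact: mem_head.
apply: IHs; first by move=> j q' js; apply: Fv; rewrite inE js orbT.
by rewrite rmorphB /= ltrBlDl -ltrBlDr.
Qed.

End VectorCone.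

(** * Every invariant cone is given by a dominant component *)

Section ConeClassification.
Variables (R : realType) (n : nat) (p : 'I_n -> nat).
Hypotheses (p_prime : forall i, prime (p i)) (p_inj : injective p).

Local Notation V := {malg rat[idx n]}.
Local Notation comp := ('I_n * int)%type.
Implicit Types (f g : V) (c d : comp).
Local Notation ev := (@ev R n p).
Local Notation lam := (lam p).

Fact zero_dyadicX : (0 : rat) \in dyadic /\ 0 <= (0 : rat) < 1.
Proof. by split=> //; exact: rpred0. Qed.

Definition dyadicX0 : dyadicX :=
  DyadicX (introT andP zero_dyadicX).

Definition basis c (x : dyadicX) : V := << 1 *g (c, x) >>.

Lemma zeta_basis c x b : zeta b (basis c x) = basis (c.1, c.2 + b) x.
Proof. by case: c => i z; exact: zetaU. Qed.

(** When a 2^z is an integer m, nothing happens to the fractional part: lambda^a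
    fixes each line of the component, and scales it by p_i^m. *)
Lemma lam_basis_int c x (a : dyadicA) (m : int) : (a : rat) * 2 ^ c.2 = m%:~R ->
  lam a (basis c x) = (p c.1)%:R ^ m *: basis c x.
Proof.
case: c => i z /= am; have /andP[_ x01] := valP x.
have fl : shift_floor z x a = m.
  rewrite /shift_floor am floorDrz ?intr_int // intrKfloor.
  by rewrite (@floor_def _ _ 0) ?add0r.
have fr : shift_frac z x a = x.
  by apply: val_inj; rewrite shift_fracE fl /= am addrK.
by rewrite [LHS]lamU fl fr mul1r [RHS]scale_monalgU mulr1.
Qed.

(** Every basis vector of a component is the image of the first one under some
    lambda^a. *)
Lemma lam_basis_frac c (x : dyadicX) : exists2 a : dyadicA,
  lam a (basis c dyadicX0) = basis c x & (a : rat) * 2 ^ c.2 = val x.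
Proof.
case: c => i z /=; pose a := DyadicA (dyadic_pow2M (- z) (dyadicX_in x)).
have az : (a : rat) * 2 ^ z = val x.
  by rewrite /= -mulrA -expfzDr // addNr mulr1.
exists a; last exact: az.
have /andP[_ x01] := valP x.
have fl : shift_floor z dyadicX0 a = 0.
  by rewrite /shift_floor add0r az; apply: floor_def; rewrite add0r.
have fr : shift_frac z dyadicX0 a = x.
  by apply: val_inj; rewrite shift_fracE fl /= -[RHS]az add0r subr0.
by rewrite [LHS]lamU fl fr mul1r.
Qed.

Lemma dyadicA_valMn (a : dyadicA) k : ((a *+ k : dyadicA) : rat) = (a : rat) *+ k.
Proof. by elim: k => // k IHk; rewrite !mulrS -IHk. Qed.

Lemma lam_iter a k f : lam (a *+ k) f = iter k (lam a) f.
Proof.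
elim: k => [|k IHk]; first by rewrite mulr0n (lam_0 p_prime).
by rewrite iterS mulrSr (lam_add p_prime) IHk.
Qed.

Lemma basis_coef c x d y : (basis c x)@_(d, y) = ((c == d) && (x == y))%:R.
Proof. by rewrite mcoeffU xpair_eqE. Qed.

Lemma malg_basis c x (r : rat) : << r *g (c, x) >> = r *: basis c x.
Proof. by rewrite [RHS]scale_monalgU mulr1. Qed.

Variable pos : set V.
Hypothesis posP : invariant_cone p pos.

Let vposP : vector_cone pos. Proof. exact: inv_vcone posP. Qed.
Let posD f g : pos f -> pos g -> pos (f + g).
Proof. exact: vconeD vposP _ _. Qed.

(** Shifts by zeta preserve the cone, so the sign of the basis vector of index
    (i, z, 0) is the same for all z. *)
Definition basis_neg i : bool := `[< ~ pos (basis (i, 0) dyadicX0) >].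

(** The basis vectors and, in [unit_vec], the first one of each component, with
    the signs that make them positive ([unit_vec_pos]). *)
Definition sbasis c x : V := (-1) ^+ basis_neg c.1 *: basis c x.
Definition unit_vec c : V := sbasis c dyadicX0.

Lemma unit_vec_inj : injective unit_vec.
Proof.
have coef c d : (unit_vec c)@_(d, dyadicX0) =
      if c == d then (-1) ^+ basis_neg c.1 else 0.
  rewrite /unit_vec /sbasis mcoeffZ basis_coef eqxx andbT.
  by case: (c == d); [exact: mulr1|exact: mulr0].
move=> c d /(congr1 (mcoeff (c, dyadicX0))) cd.
have {cd} := etrans (esym (coef c c)) (etrans cd (coef d c)).
rewrite eqxx; case: (eqVneq d c) => [-> //|_] /eqP.
by rewrite signr_eq0.
Qed.

Lemma zeta_unit c b : zeta b (unit_vec c) = unit_vec (c.1, c.2 + b).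
Proof. by rewrite /unit_vec /sbasis zetaZ zeta_basis. Qed.

Lemma unit_vec_pos c : pos (unit_vec c).
Proof.
case: c => i z; rewrite -[z]add0r -(zeta_unit (i, 0)).
apply: (inv_cone_zeta posP); rewrite /unit_vec /sbasis /=.
rewrite /basis_neg; case: asboolP => [neg|/contrapT]; last by rewrite expr0 scale1r.
rewrite expr1 scaleN1r.
have : basis (i, 0) dyadicX0 <> 0.
  move/(congr1 (fun f : V => f@_((i, 0), dyadicX0))).
  by rewrite basis_coef mcoeff0 !eqxx => /eqP; rewrite oner_eq0.
by case/(vcone_total vposP).
Qed.

Lemma lam_unit_int c (a : dyadicA) (m : int) : (a : rat) * 2 ^ c.2 = m%:~R ->
  lam a (unit_vec c) = (p c.1)%:R ^ m *: unit_vec c.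
Proof.
move=> am; rewrite /unit_vec /sbasis lamZ (lam_basis_int _ am).
by rewrite [LHS]scalerA [RHS]scalerA mulrC.
Qed.

Lemma lam_unit_frac c (x : dyadicX) : exists2 a : dyadicA,
  lam a (unit_vec c) = sbasis c x & (a : rat) * 2 ^ c.2 = val x.
Proof.
have [a ax aE] := lam_basis_frac c x.
by exists a; [rewrite /unit_vec /sbasis lamZ ax|exact: aE].
Qed.

(** Inside a component the order is that of the reals: a suitable lambda^a takes
    the unit vector to the basis vector of index x, and its N-th power
    multiplies the unit vector by p_i^(N x), for N a denominator of x. *)
Lemma sbasis_approx c (x : dyadicX) (r q : rat) :
  ratr q < ratr r * (p c.1)%:R `^ ratr (val x) :> R ->
  pos (r *: sbasis c x - q *: unit_vec c).
Proof.
move=> qrt.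
have [|N N0 /(_ _ (mem_head _ _))[m xN]] := @dyadic_common_den [:: val x].
  by move=> y; rewrite inE => /eqP ->; exact: dyadicX_in.
have t0 : 0 < (p c.1)%:R `^ ratr (val x) :> R.
  by rewrite powR_gt0 // ltr0n prime_gt0.
have tN : ((p c.1)%:R `^ ratr (val x)) ^+ N = ratr ((p c.1)%:R ^ m) :> R.
  rewrite -powR_mulrn ?powR_ge0 // -powRrM fmorphXz /= ratr_nat.
  rewrite -powR_intmul ?ler0n //.
  by rewrite -(ratr_nat R N) -rmorphM xN /= ratr_int.
have [a ua ax] := lam_unit_frac c x.
have aN : ((a *+ N : dyadicA) : rat) * 2 ^ c.2 = m%:~R.
  by rewrite -xN -ax dyadicA_valMn mulrnAl mulr_natr.
have lamN := lam_unit_int aN; rewrite lam_iter in lamN.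
have posT h : pos h -> pos (lam a h) by exact: (@inv_cone_lam _ _ _ posP h a).
rewrite -ua.
exact: (root_eigen_compare vposP posT (unit_vec_pos c) N0 lamN t0 tN qrt).
Qed.

(** By [unit_vec_dominates] this compares the sizes of whole components. *)
Definition unit_vec_lt c d := pos (unit_vec d - unit_vec c).

Lemma unit_vec_lt_neq c d : unit_vec_lt c d -> c <> d.
Proof.
by rewrite /unit_vec_lt => + cd; rewrite cd subrr; exact: vcone0 vposP.
Qed.

(** lambda^(m 2^K) multiplies the two unit vectors by the m-th powers of
    p_i^(2^(K+z)) and p_j^(2^(K+w)).  By unique factorization these integers
    differ when (i,z) and (j,w) do, so the ratio rho of the multipliers is
    different from 1 and its integer powers are unbounded. *)
Lemma unit_vec_dominates c d (N : rat) :
  unit_vec_lt c d -> pos (unit_vec d - N *: unit_vec c).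
Proof.
move=> cd; have c_neq_d := unit_vec_lt_neq cd.
(* K makes both exponents K + z and K + w nonnegative. *)
pose K := (`|c.2| + `|d.2|)%N.
have [A AE] : exists A : nat, A%:Z = K%:Z + c.2.
  by exists `|(K%:Z + c.2)%R|%N; rewrite gez0_abs // /K; lia.
have [D DE] : exists D : nat, D%:Z = K%:Z + d.2.
  by exists `|(K%:Z + d.2)%R|%N; rewrite gez0_abs // /K; lia.
pose rho : rat := (p c.1)%:R ^+ (2 ^ A) / (p d.1)%:R ^+ (2 ^ D).
have p0 i : 0 < (p i)%:R :> rat by rewrite ltr0n prime_gt0.
have rho0 : 0 < rho by rewrite divr_gt0 // exprn_gt0.
have rho1 : rho != 1.
  apply: contra_not_neq c_neq_d => /(canRL (divfK _)).
  rewrite mul1r expf_neq0 ?gt_eqF // => /(_ isT) /eqP.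
  rewrite -!natrX eqr_nat => /eqP/prime_expn_inj[]//; first by rewrite expn_gt0.
  move=> /p_inj cd1 /eqP; rewrite eqn_exp2l // => /eqP AD.
  rewrite (surjective_pairing c) (surjective_pairing d) cd1; congr (_, _).
  by apply: (addrI K%:Z); rewrite -AE -DE AD.
have [m Nm] := exprz_unbounded N rho0 rho1.
pose a := DyadicA (dyadic_pow2M K%:Z (dyadic_int m)).
have aE e E : E%:Z = K%:Z + e -> (a : rat) * 2 ^ e = (m * (2 ^ E)%N)%:~R.
  move=> EE; rewrite /= -mulrA -expfzDr // -EE rmorphM /=.
  by rewrite -exprnP -natrX pmulrn.
have posT h : pos h -> pos (lam a h) by exact: (@inv_cone_lam _ _ _ posP h a).
apply: (eigen_dominates vposP posT (unit_vec_pos c) cd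
  (lam_unit_int (aE _ _ AE)) (lam_unit_int (aE _ _ DE))).
  exact: exprz_gt0.
suff -> : (p c.1)%:R ^ (m * (2 ^ A)%N) / (p d.1)%:R ^ (m * (2 ^ D)%N) = rho ^ m.
  exact: Nm.
have pw (y : rat) E : (y ^+ E) ^ m = y ^ (m * E) by rewrite exprnP exprz_exp mulrC.
by rewrite /rho expfzMl exprz_inv -invr_expz !pw.
Qed.

Lemma unit_vec_lt_total c d : unit_vec_lt c d \/ c = d \/ unit_vec_lt d c.
Proof.
have [cd|cd] := eqVneq c d; first by right; left.
have /(vcone_total vposP)[dc|dc] : unit_vec d - unit_vec c <> 0.
- by move/subr0_eq/unit_vec_inj/esym/eqP; rewrite (negbTE cd).
- by left.
- by right; right; rewrite /unit_vec_lt -opprB.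
Qed.

Lemma unit_vec_lt_order : comp_order unit_vec_lt.
Proof.
split.
- by move=> c /unit_vec_lt_neq.
- move=> c d e cd de; have := posD de cd.
  by rewrite /unit_vec_lt addrA subrK.
- exact: unit_vec_lt_total.
- move=> c d b cd; have zB : zeta b (unit_vec d - unit_vec c)
      = zeta b (unit_vec d) - zeta b (unit_vec c) by exact: linearB.
  rewrite /unit_vec_lt -[unit_vec (d.1, _)]zeta_unit.
  rewrite -[unit_vec (c.1, _)]zeta_unit -zB.
  exact: (@inv_cone_zeta _ _ _ posP _ b cd).
Qed.

(** Term by term: a term of f in the component c is compared with the unit vector
    as real numbers are, and a term in a smaller component is negligible. *)
Lemma cone_lower_bound c f (q : rat) :
  (forall k, k \in msupp f -> k.1 = c \/ unit_vec_lt k.1 c) ->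
  ratr q < (-1) ^+ basis_neg c.1 * ev c f -> pos (f - q *: unit_vec c).
Proof.
move=> below; rewrite [f in f - _]monalgE /ev /lin_ext mulr_sumr.
apply: (sum_lower_bound vposP); first exact: unit_vec_pos.
move=> [d x] {}q /below /= + ltq; set r := f@__ in ltq *.
have -> : << r *g (d, x) >> = ((-1) ^+ basis_neg d.1 * r) *: sbasis d x.
  by rewrite [RHS]scalerA mulrAC -expr2 sqrr_sign mul1r malg_basis.
case=> [dc|dc].
  subst d; apply: sbasis_approx; move: ltq; rewrite /weight /= eqxx.
  by rewrite rmorphM rmorph_sign mulrA.
move: ltq; rewrite /weight /=; case: (d =P c) => [/(unit_vec_lt_neq dc) []|_].
rewrite !mulr0 ltrq0 => q0.
(* Bound the term from below by a negative multiple q1 of the unit vector of its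
   own component, which is negligible before the one of c. *)
set v : R := ratr ((-1) ^+ basis_neg d.1 * r) * (p d.1)%:R `^ ratr (val x).
have /rat_in_itvoo[q1] : Num.min 0 v - 1 < Num.min 0 v by rewrite gtrBl.
rewrite in_itv /= lt_min => /andP[_ /andP[q1_lt0 q1v]].
apply: (pos_sub_trans vposP q0 (q' := q1)); first exact: sbasis_approx.
exact: unit_vec_dominates.
Qed.

(** The leading-component cone is contained in [pos] by [cone_lower_bound] with
    q = 0; since it already contains f or -f for each nonzero f, it is all of
    [pos]. *)
Theorem invariant_cone_is_lead_cone :
  comp_order unit_vec_lt /\ pos = lead_cone R p basis_neg unit_vec_lt.
Proof.
split; first exact: unit_vec_lt_order.
have leadP f : lead_cone R p basis_neg unit_vec_lt f -> pos f.
  case=> c [f0 above]; rewrite -[f]subr0 -(scale0r (unit_vec c)).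
  apply: cone_lower_bound; last by rewrite rmorph0.
  move=> [d x] xf; case: (unit_vec_lt_total d c) => [|[|cd]]; [by right|by left|].
  have := ev_eq0 p_prime (above d cd) x.
  by move/eqP; rewrite mcoeff_eq0 xf.
apply/seteqP; split=> f; last exact: leadP.
move=> pf; have f0 : f <> 0.
  by move=> f0; move: pf; rewrite f0; exact: vcone0 vposP.
case: (lead_cone_total R p_prime basis_neg unit_vec_lt_order f0) => [//|/leadP].
by move/(pos_anti vposP pf).
Qed.

End ConeClassification.

(** * Orders of G_n are lexicographic *)

Lemma mult_positive_coneP (V : zmodType) (C : set (mult V)) :
  is_positive_cone C <-> vector_cone (C : set V).
Proof.
split=> [/positive_coneP[n1 tot cM _]|[n0 cD tot]]; first by split.
apply/positive_coneP; split=> // g a Ca.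
by rewrite (multC g a) mulgK.
Qed.

Section RankOne.
Variables (V : zmodType) (v : V -> rat).
Hypotheses (vD : {morph v : x y / x + y}) (v_inj : injective v).

(** The two orders of a group of rank one, embedded in the rationals by v; [true]
    stands for the reversed one. *)
Definition sign_cone (s : bool) : set (mult V) := [set a | 0 < (-1) ^+ s * v a].

Let v0 : v 0 = 0.
Proof. by apply: (addIr (v 0)); rewrite -vD !add0r. Qed.

Let vN a : v (- a) = - v a.
Proof. by apply: (addIr (v a)); rewrite -vD !addNr v0. Qed.

Let vMn a k : v (a *+ k) = v a *+ k.
Proof. by elim: k => [|k IHk]; rewrite ?mulr0n ?v0 // !mulrS vD IHk. Qed.

Lemma sign_cone_vector_cone s : vector_cone (sign_cone s : set V).
Proof.
rewrite /sign_cone; split=> [|f g|f f0] /=.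
- by rewrite v0 mulr0 ltxx.
- by rewrite vD mulrDr; exact: addr_gt0.
- rewrite vN mulrN oppr_gt0; apply/orP; rewrite orbC -neq_lt.
  rewrite mulf_neq0 ?signr_eq0 // -v0 (inj_eq v_inj); exact/eqP.
Qed.

Lemma sign_cone_positive s : is_positive_cone (sign_cone s).
Proof. exact/mult_positive_coneP/sign_cone_vector_cone. Qed.

(** Any a has a multiple in common with u or with -u, so the sign of u determines
    the sign of a. *)
Lemma rank_one_cone (u : V) (C : set (mult V)) : v u = 1 -> is_positive_cone C ->
  exists s, C = sign_cone s.
Proof.
move=> vu /mult_positive_coneP[n0 cD tot].
have cMn a k : C a -> C (a *+ k.+1 : V).
  by move=> Ca; elim: k => // k IHk; rewrite mulrS; exact: cD.
have u0 : u <> 0.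
  by move=> u0; move: vu => /eqP; rewrite u0 v0 eq_sym oner_eq0.
have [s [w Cw vw]] : exists s : bool, exists2 w, C w & v w = (-1) ^+ s.
  case: (tot u u0) => Cu; first by exists false, u; rewrite // vu expr0.
  by exists true, (- u); rewrite // vN vu expr1.
have CP a : 0 < (-1) ^+ s * v a -> C a.
  set r := _ * v a => r0.
  have a0 : a <> 0 by move=> a0; move: r0; rewrite /r a0 v0 mulr0 ltxx.
  case: (tot a a0) => // CNa; exfalso.
  have [num [den numE]] := pos_rat_frac r0.
  apply: n0; have := cD _ _ (cMn _ num Cw) (cMn _ den CNa).
  suff -> : w *+ num.+1 + (- a) *+ den.+1 = 0 by [].
  apply: v_inj; rewrite vD !vMn v0 vN vw mulNrn.
  apply/eqP; rewrite subr_eq0; apply/eqP.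
  have -> : v a = (-1) ^+ s * r by rewrite mulrA -expr2 sqrr_sign mul1r.
  rewrite -mulrnAr -[LHS]mulr_natr; congr (_ * _).
  by rewrite numE mulr_natr.
exists s; apply/seteqP; split=> [a Ca|]; last exact: CP.
rewrite /sign_cone /=; have a0 : v a != 0.
  by rewrite -v0 (inj_eq v_inj); apply/eqP => a0; rewrite a0 in Ca.
have : (-1) ^+ s * v a != 0 by rewrite mulf_neq0 ?signr_eq0.
rewrite neq_lt => /orP[neg|//]; exfalso.
have CNa : C (- a) by apply: CP; rewrite vN mulrN oppr_gt0.
by apply: n0; rewrite -(subrr a); exact: cD.
Qed.

End RankOne.

Section Groups.
Variables (n : nat) (p : 'I_n -> nat).
Hypothesis p_prime : forall i, prime (p i).

Local Notation V := {malg rat[idx n]}.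

Definition dyadicA1 : dyadicA := DyadicA (dyadic_int 1).

Definition lex_cone_M (s : bool) (pos : set V) : set (Mn p_prime) :=
  lex_cone (lam_actP p_prime) (sign_cone (dyadicA_val : dyadicA -> rat) s)
    (pos : set (Pn n)).

Definition lex_cone_G (s s' : bool) (pos : set V) : set (Gn p_prime) :=
  lex_cone (zeta_actP p_prime) (sign_cone (intr : int -> rat) s)
    (lex_cone_M s' pos).

Let valD : {morph (dyadicA_val : dyadicA -> rat) : x y / x + y}.
Proof. by []. Qed.
Let val_inj' : injective (dyadicA_val : dyadicA -> rat).
Proof. exact: val_inj. Qed.
Let intrD' : {morph (intr : int -> rat) : x y / x + y}.
Proof. exact: intrD. Qed.
Let intr_inj' : injective (intr : int -> rat).
Proof. exact: intr_inj. Qed.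

Lemma lex_cone_G_positive s s' pos : invariant_cone p pos ->
  is_positive_cone (lex_cone_G s s' pos).
Proof.
move=> [vpos posl posz]; apply: lex_cone_positive.
- exact: sign_cone_positive.
- apply: lex_cone_positive.
  + exact: sign_cone_positive.
  + exact/mult_positive_coneP.
  + by move=> f a; exact: posl.
- move=> [a f] b; rewrite /lex_cone_M /lex_cone /sign_cone /=.
  case=> [a0|[a0 pf]]; [left|right].
    by rewrite mulrA mulr_gt0 // exprz_gt0.
  split; last exact: posz.
  by apply: val_inj; rewrite /= a0 mul0r.
Qed.

(** On a basis vector some power of lambda^a acts as a scalar p_i^m with m <> 0,
    and [telescope_onto] applies; the image of 1 - lambda^a is a subspace. *)
Lemma sub_lam_onto (a : dyadicA) (f : V) : a <> 0 -> exists g, g - lam p a g = f.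
Proof.
move=> a0; pose im (f : V) := exists g, g - lam p a g = f.
have im_basis c x : im (basis c x).
  have [|N N0 /(_ _ (mem_head _ _))[m aN]] :=
      @dyadic_common_den [:: (a : rat) * 2 ^ c.2].
    by move=> y; rewrite inE => /eqP ->; rewrite dyadic_pow2M ?dyadicA_in.
  have aNE : ((a *+ N : dyadicA) : rat) * 2 ^ c.2 = m%:~R.
    by rewrite dyadicA_valMn mulrnAl -aN mulr_natr.
  have m0 : m != 0.
    rewrite -(intr_eq0 rat) -aN !mulf_neq0 ?expfz_neq0 ?pnatr_eq0 -?lt0n //.
    by apply/eqP => aa0; apply: a0; exact: val_inj.
  have pm1 : (p c.1)%:R ^ m != 1 :> rat.
    apply/eqP => pm; case/eqP: m0.
    have p0 : 0 < (p c.1)%:R :> rat by rewrite ltr0n prime_gt0.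
    have p1 : (p c.1)%:R != 1 :> rat by rewrite pnatr_eq1 gtn_eqF ?prime_gt1.
    by apply: (ieexprIz p0 p1); rewrite pm.
  have := lam_basis_int p x aNE; rewrite (lam_iter p_prime) => /telescope_onto.
  by apply.
have im0 : im 0 by exists 0; rewrite linear0 subr0.
have imD : forall g h, im g -> im h -> im (g + h).
  move=> g h [g' <-] [h' <-]; exists (g' + h').
  by rewrite linearD /= opprD addrACA.
have imZ r g : im g -> im (r *: g).
  by move=> [g' <-]; exists (r *: g'); rewrite lamZ scalerBr.
suff : im f by [].
rewrite [f]monalgE; apply: (big_ind im) => // -[c x] _.
by rewrite malg_basis; exact: imZ.
Qed.

(** For a <> 0 the conjugates of lambda^a by P_n fill the whole coset
    lambda^a P_n, by [sub_lam_onto]; so P_n is convex. *)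
Lemma cone_M_lex (C : set (Mn p_prime)) : is_positive_cone C ->
  exists s, C = lex_cone_M s [set f | C (sd_inl (lam_actP p_prime) f)].
Proof.
move=> Cc; have := cone_sd_inr Cc.
case/(rank_one_cone valD val_inj' (u := dyadicA1) erefl) => s Cs.
exists s; rewrite /lex_cone_M -Cs; apply: cone_lex => // a f a0 Ca.
have [g <-] := sub_lam_onto f a0.
have := cone_conj_inr (- g : Pn n) Cc Ca.
set x := (X in C (_, X)); suff -> : x = g - lam p a g by [].
have -> : x = lam p a (- g) - (- g) by [].
by rewrite raddfN opprK addrC.
Qed.

Lemma exists_int_mul_lt (y w : rat) : y != 0 -> exists m : int, y * m%:~R < w.
Proof.
move=> y0; have fl := floor_itv (w / y).
have := y0; rewrite neq_lt => /orP[y_lt0|y_gt0].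
  exists (Num.floor (w / y) + 1); rewrite mulrC -ltr_ndivrMr //.
  by have /andP[] := fl.
exists (Num.floor (w / y) - 1); rewrite mulrC -ltr_pdivlMr //.
have /andP[flw _] := fl.
by rewrite intrD; apply: lt_le_trans flw; rewrite gtrDl oppr_lt0.
Qed.

(** The conjugates of zeta^b by powers of lambda are the zeta^b lambda^t with t in
    a nonzero ideal of the dyadic rationals.  They all have the sign of zeta^b,
    and below any given element of A there is such a t, so an arbitrary
    zeta^b m with m in M_n is the product of a conjugate of zeta^b and of a
    positive element of M_n. *)
Lemma cone_G_lex (C : set (Gn p_prime)) : is_positive_cone C ->
  exists s s' pos, invariant_cone p pos /\ C = lex_cone_G s s' pos.
Proof.
move=> Cc; have := cone_sd_inr Cc.
case/(rank_one_cone intrD' intr_inj' (u := 1) erefl) => s Cs.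
have CMc := cone_sd_inl Cc; have [s' CM] := cone_M_lex CMc.
set pos := (X in lex_cone_M _ X) in CM.
exists s, s', pos; split.
  split.
  - exact/mult_positive_coneP/(cone_sd_inl CMc).
  - by move=> f a pf; exact (@cone_sd_phi _ _ _ (lam_actP p_prime) _ f a CMc pf).
  - move=> f b pf.
    have E : zeta_act (sd_inl (lam_actP p_prime) f) b
        = sd_inl (lam_actP p_prime) (zeta b f : Pn n).
      by congr pair; apply: val_inj; rewrite /= mul0r.
    have := @cone_sd_phi _ _ _ (zeta_actP p_prime) _
      (sd_inl (lam_actP p_prime) f) (b : mult int) Cc pf.
    by rewrite E.
rewrite /lex_cone_G -Cs -CM; apply: cone_lex => // b [a f] b0 Cb.
have [c cE] : exists c : int,
    (-1) ^+ s' * (2 ^ (- (b : int)) - 1) * c%:~R < (-1) ^+ s' * (a : rat).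
  apply: exists_int_mul_lt; rewrite mulf_neq0 ?signr_eq0 // subr_eq0.
  apply/eqP => b2; case: b0; apply: oppr_inj; rewrite oppr0.
  by apply: (@ieexprIz rat 2).
pose k : Mn p_prime := sd_inr (lam_actP p_prime) (DyadicA (dyadic_int c)).
have := @cone_conj_inr _ _ _ (zeta_actP p_prime) C k b Cc Cb.
set k' := (X in C (_, X)) => Ck'.
pose m : Mn p_prime := (k'^-1 * (a, f))%g.
have Cm : C (sd_inl (zeta_actP p_prime) m).
  suff : lex_cone_M s' pos m by rewrite -CM.
  left; rewrite /sign_cone.
  rewrite /= -subr_gt0 in cE *.
  suff -> : (-1) ^+ s' * (- (c%:~R * 2 ^ (- (b : int)) - c%:~R) + dyadicA_val a)
    = (-1) ^+ s' * dyadicA_val a - (-1) ^+ s' * (2 ^ (- (b : int)) - 1) * c%:~R.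
    exact: cE.
  rewrite -mulrA -mulrBr mulrBl mul1r mulrC [in RHS]mulrC addrC.
  by rewrite [c%:~R * _]mulrC.
have /positive_coneP[_ _ cM _] := Cc.
have := cM _ _ Ck' Cm.
set x := (X in C X); suff -> : x = (b, (a, f)) by [].
rewrite /x sd_mulE /= (act1 (zeta_actP p_prime)) mulg1.
by rewrite /m mulVKg.
Qed.

End Groups.

Arguments lex_cone_M {n p} p_prime s pos.
Arguments lex_cone_G {n p} p_prime s s' pos.

(** * Countability *)

Definition cut_code : Type := (bool * bool * int)%type.
HB.instance Definition _ := Countable.on cut_code.

(** The subsets of the integers that are closed upwards or downwards: the first
    bit tells the constant ones from the half-lines, the second one gives the
    constant or the direction, and the integer is the end point. *)
Definition cut (k : cut_code) (d : int) : bool :=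
  if k.1.1 then k.1.2 else if k.1.2 then k.2 <= d else d <= k.2.

Lemma cut_up_closed (S : int -> Prop) : (forall d, S d -> S (d + 1)) ->
  exists k, forall d, S d <-> cut k d.
Proof.
move=> Sup; have SupD d (m : nat) : S d -> S (d + m%:Z).
  move=> Sd; elim: m => [|m IHm]; first by rewrite addr0.
  by rewrite -addn1 PoszD addrA; exact: Sup.
have Sle d e : S d -> d <= e -> S e.
  move=> Sd de; rewrite -(subrK d e) addrC -[e - d]gez0_abs ?subr_ge0 //.
  exact: SupD.
have [[d0 Nd0]|all] := pselect (exists d, ~ S d); last first.
  exists (true, true, 0) => d; split=> [//|_].
  by apply: contrapT => Nd; apply: all; exists d.
have [[d1 Sd1]|none] := pselect (exists d, S d); last first.
  exists (true, false, 0) => d; split=> [Sd|//].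
  by case: none; exists d.
have d01 : d0 <= d1 by case: (lerP d0 d1) => // /ltW /(Sle _ _ Sd1) /Nd0.
have ex : exists m : nat, `[< S (d0 + m%:Z) >].
  by exists `|(d1 - d0)%R|%N; apply/asboolP; apply: Sle Sd1 _; lia.
have [m /asboolP Sm m_min] := ex_minnP ex.
exists (false, true, d0 + m%:Z) => d.
rewrite /cut /=; split=> [Sd|]; last exact: Sle.
rewrite leNgt; apply/negP => dm.
have dd0 : d0 <= d by case: (lerP d0 d) => // /ltW /(Sle _ _ Sd) /Nd0.
have /m_min : `[< S (d0 + `|(d - d0)%R|%N%:Z) >].
  by apply/asboolP; apply: Sle Sd _; lia.
lia.
Qed.

(** A set closed downwards is the mirror image of one closed upwards. *)
Lemma cut_monotone (S : int -> Prop) :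
  (forall d, S d -> S (d + 1)) \/ (forall d, S (d + 1) -> S d) ->
  exists k, forall d, S d <-> cut k d.
Proof.
case=> [|Sdown]; first exact: cut_up_closed.
have [|[[c u] k] kS] := @cut_up_closed (fun d => S (- d)).
  by move=> d; rewrite opprD => Sd; apply: Sdown; rewrite subrK.
exists (c, if c then u else ~~ u, - k) => d.
rewrite -[d in S d]opprK kS /cut /=.
by case: c {kS}; case: u => //=; split; lia.
Qed.

Section Coding.
Variables (R : realType) (n : nat) (p : 'I_n -> nat).
Hypotheses (p_prime : forall i, prime (p i)) (p_inj : injective p).
Local Notation comp := ('I_n * int)%type.

Definition cone_code : Type :=
  (bool * bool * {ffun 'I_n -> bool} * {ffun 'I_n * 'I_n -> cut_code})%type.
HB.instance Definition _ := Countable.on cone_code.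

(** The signs of zeta, of lambda and of the components, and the cuts of
    [comp_order_cut]. *)
Definition decode_cone (x : cone_code) : set (Gn p_prime) :=
  let: (s, s', sg, cuts) := x in
  lex_cone_G p_prime s s'
    (lead_cone R p sg (fun c d => cut (cuts (c.1, d.1)) (d.2 - c.2))).

(** By shift invariance, [prec] is known from the sets of the d such that (i,0)
    precedes (j,d).  According to whether (j,0) precedes (j,1) or the converse,
    transitivity makes such a set closed upwards or downwards. *)
Lemma comp_order_cut (prec : comp -> comp -> Prop) : comp_order prec ->
  exists cuts : {ffun 'I_n * 'I_n -> cut_code},
    prec = fun c d => cut (cuts (c.1, d.1)) (d.2 - c.2).
Proof.
move=> [irr tr tot sh].
have /choice[cuts cutsE] (ij : 'I_n * 'I_n) : exists k, forall d : int,
    prec (ij.1, 0) (ij.2, d) <-> cut k d.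
  apply: cut_monotone; case: (tot (ij.2, 0) (ij.2, 1)) => [up|[[]//|down]].
    left=> d ijd; apply: tr ijd _.
    by move: (sh _ _ d up); rewrite /= add0r addrC.
  right=> d ijd; apply: tr ijd _.
  by move: (sh _ _ d down); rewrite /= add0r addrC.
exists [ffun ij => cuts ij]; apply/funext => -[i z]; apply/funext => -[j w].
apply/propext; rewrite ffunE /= -cutsE /=.
split=> [/sh - /(_ (- z))|/sh - /(_ z)] /=.
  by rewrite subrr.
by rewrite add0r subrK.
Qed.

Lemma decode_cone_onto (C : set (Gn p_prime)) : is_positive_cone C ->
  exists x, C = decode_cone x.
Proof.
move=> /cone_G_lex[s [s' [pos [posP ->]]]].
have [precP posE] := invariant_cone_is_lead_cone R p_prime p_inj posP.
have [cuts cutsE] := comp_order_cut precP.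
exists (s, s', [ffun i => basis_neg pos i], cuts); rewrite /decode_cone -cutsE.
congr lex_cone_G; rewrite {1}posE; congr lead_cone.
by apply/funext => i; rewrite ffunE.
Qed.

Lemma countable_cones : countable (space_of_orders (Gn p_prime)).
Proof.
apply: (@sub_countable _ _ _ (decode_cone @` setT)).
  apply: subset_card_le => C /decode_cone_onto[x ->].
  by exists x.
exact: sub_countable (card_image_le _ _) (countableP _).
Qed.

Lemma lead_cone_basis_sub (prec : comp -> comp -> Prop) c d :
  comp_order prec -> prec d c ->
  lead_cone R p (fun=> false) prec (basis c dyadicX0 - basis d dyadicX0).
Proof.
move=> [irr tr _ _] dc.
have evb e e' : ev R p e (basis e' dyadicX0) = if e' == e then 1 else 0.
  rewrite /ev /basis lin_extU rmorph1 mul1r /weight /=; case: eqP => // _.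
  by rewrite rmorph0 powRr0.
have evs e : ev R p e (basis c dyadicX0 - basis d dyadicX0)
    = (if c == e then 1 else 0) - (if d == e then 1 else 0).
  rewrite [LHS]evD [X in _ + X]evN; congr (_ - _); exact: evb.
exists c; split=> [|e ce]; rewrite evs.
  rewrite eqxx mul1r; case: eqP => [dc'|_]; last by rewrite subr0 ltr01.
  by case: (irr c); rewrite -{1}dc'.
case: eqP => [ce'|_]; first by case: (irr c); rewrite {2}ce'.
case: eqP => [de|_]; last by rewrite subr0.
by case: (irr d); apply: tr dc _; rewrite de.
Qed.

End Coding.

(** * Infinitely many orders *)

Section Infinite.
Variables (R : realType) (n : nat) (p : 'I_n -> nat).
Hypothesis n_ge2 : (2 <= n)%N.
Hypothesis p_prime : forall i, prime (p i).
Local Notation comp := ('I_n * int)%type.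

Let i0 : 'I_n := Ordinal (ltnW n_ge2).
Let i1 : 'I_n := Ordinal n_ge2.

(** The chains of components (i,z), for fixed i, are interleaved with period n,
    the chain of i = 0 being advanced by k periods; the residue modulo n
    recovers i. *)
Definition shift_key (k : nat) (c : comp) : int :=
  n%:Z * (c.2 + (if c.1 == i0 then k%:Z else 0)) + (c.1 : nat)%:Z.

Lemma shift_key_order k : comp_order (fun c d => shift_key k c < shift_key k d).
Proof.
split.
- by move=> c; rewrite ltxx.
- by move=> c d e; exact: lt_trans.
- move=> c d; have [lt|gt|kE] := ltgtP (shift_key k c) (shift_key k d);
    [by left|by right; right|right; left].
  have cd1 : c.1 = d.1.
    apply: val_inj; apply/eqP; rewrite -eqz_nat; apply/eqP.
    have md (e : comp) : (shift_key k e %% n)%Z = (e.1 : nat)%:Z.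
      by rewrite /shift_key mulrC modzMDl modz_small // ltz_nat ltn_ord.
    by rewrite -!md kE.
  rewrite (surjective_pairing c) (surjective_pairing d) cd1; congr (_, _).
  move: kE; rewrite /shift_key cd1 => /addIr /mulfI nI.
  by apply: addIr; apply: nI; rewrite -lt0n; exact: ltnW.
- move=> [i z] [j w] b; rewrite /shift_key /= !mulrDr; lia.
Qed.

Lemma lex_cone_G_restrict s s' pos (f : Pn n) :
  lex_cone_G p_prime s s' pos
    (sd_inl (zeta_actP p_prime) (sd_inl (lam_actP p_prime) f)) <-> pos f.
Proof.
split=> [[|[_ [|[_ //]]]]|pf]; last by right; split=> //; right.
  by rewrite /sign_cone /= mulr0 ltxx.
by rewrite /sign_cone /= mulr0 ltxx.
Qed.

(** For k < k', the component (0,0) precedes (1,k) for the offset k and follows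
    it for the offset k', which shows in the sign of the difference of the two
    basis vectors. *)
Lemma infinite_cones : infinite_set (space_of_orders (Gn p_prime)).
Proof.
pose pos k :=
  lead_cone R p (fun=> false) (fun c d => shift_key k c < shift_key k d).
pose C k := lex_cone_G p_prime false false (pos k).
have posP k : invariant_cone p (pos k).
  exact/lead_cone_invariant/shift_key_order.
have C_neq k k' : (k < k')%N -> C k <> C k'.
  move=> kk' CE.
  have posE : pos k = pos k'.
    apply/funext => f; apply/propext.
    rewrite -(lex_cone_G_restrict false false (pos k)).
    by rewrite -(lex_cone_G_restrict false false (pos k')) -/(C k) -/(C k') CE.
  have kf : pos k (basis (i1, k%:Z) dyadicX0 - basis (i0, 0) dyadicX0).
    apply: lead_cone_basis_sub; first exact: shift_key_order.
    by rewrite /shift_key /=; lia.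
  have kf' : pos k' (basis (i0, 0) dyadicX0 - basis (i1, k%:Z) dyadicX0).
    apply: lead_cone_basis_sub; first exact: shift_key_order.
    by rewrite /shift_key /=; nia.
  rewrite -posE in kf'; apply: (pos_anti (inv_vcone (posP k)) kf).
  by rewrite opprB; exact: kf'.
apply/infiniteP; apply: (@card_le_trans _ _ _ (C @` setT)).
  have /card_esym : (C @` [set: nat] #= [set: nat])%card.
    apply: inj_card_eq => k k' _ _ CE.
    by case: (ltngtP k k') => // /C_neq; rewrite CE.
  by move/card_eqPle => [].
apply: subset_card_le => _ [k _ <-].
exact: lex_cone_G_positive.
Qed.
End Infinite.

Theorem theorem4p7 (n : nat) (n_ge2 : (2 <= n)%N) (p : 'I_n -> nat)
    (p_prime : forall i, prime (p i)) (p_inj : injective p) :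
  (orders (Gn p_prime) #= [set: nat])%card /\
  (space_of_orders (Gn p_prime) #= [set: nat])%card.
Proof.
have coneN : (space_of_orders (Gn p_prime) #= [set: nat])%card.
  apply: eq_card_nat; first exact: (@countable_cones Rdefinitions.R).
  exact: (@infinite_cones Rdefinitions.R).
split=> //; exact: card_eq_trans (card_orders _) coneN.
Qed.
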